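(* Let $T,M,N\ge1$ be integers, $\rho>0$, and let $\bar{\mathbf{S}}^{(0)},\dots,\bar{\mathbf{S}}^{(L-1)}\in\mathbb{C}^{2T\times M}$ be candidate transmit matrices. For $\bar{\mathbf{S}}\in\mathbb{C}^{2T\times M}$ let $p(\bar{\mathbf{Y}}\mid\bar{\mathbf{S}})$ be the probability density of $\bar{\mathbf{Y}}=\sqrt{\rho}\,\bar{\mathbf{S}}\mathbf{H}+\bar{\mathbf{W}}\in\mathbb{C}^{2T\times N}$, where the entries of $\mathbf{H}\in\mathbb{C}^{M\times N}$ and $\bar{\mathbf{W}}\in\mathbb{C}^{2T\times N}$ are all mutually independent and $\mathcal{CN}(0,1)$ distributed. Then for every $\bar{\mathbf{Y}}\in\mathbb{C}^{2T\times N}$, $$\operatorname*{argmax}_{l\in\{0,\dots,L-1\}}p(\bar{\mathbf{Y}}\mid\bar{\mathbf{S}}^{(l)})=\operatorname*{argmax}_{l\in\{0,\dots,L-1\}}\ \operatorname{tr}\Big\{\rho\,\bar{\mathbf{Y}}^\dagger\bar{\mathbf{S}}^{(l)}\big(\mathbf{I}_M+\rho\,\bar{\mathbf{S}}^{(l)\dagger}\bar{\mathbf{S}}^{(l)}\big)^{-1}\bar{\mathbf{S}}^{(l)\dagger}\bar{\mathbf{Y}}\Big\}-N\ln\det\big(\mathbf{I}_M+\rho\,\bar{\mathbf{S}}^{(l)\dagger}\bar{\mathbf{S}}^{(l)}\big).$$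
   Context: $\dagger$ denotes conjugate transpose. $\mathcal{CN}(0,1)$ is the circularly symmetric complex Gaussian distribution with density $\pi^{-1}e^{-|x|^2}$ on $\mathbb{C}$. $\operatorname{argmax}$ denotes the set of all maximizers. (Here $\bar{\mathbf{Y}}$ stacks two consecutive received $T\times N$ blocks and $\bar{\mathbf{S}}$ the two corresponding transmitted $T\times M$ blocks.) *)

(* Defs.v *)
From HB Require Import structures.
From mathcomp Require Import all_boot all_order all_algebra.
From mathcomp Require Import all_classical all_reals all_analysis.
From mathcomp Require Import complex spectral.

Set Implicit Arguments.
Unset Strict Implicit.
Unset Printing Implicit Defensive.
Import Order.TTheory GRing.Theory Num.Theory.
Import numFieldNormedType.Exports.

Local Open Scope classical_set_scope.
Local Open Scope ring_scope.
Local Open Scope complex_scope.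

(* R[i]^o carries the topology of the modulus; R[i] itself has no topology in
   the library. *)
HB.instance Definition _ (R : realType) := PseudoPointedMetric.copy R[i] R[i]^o.

(* C is identified with R * R: this is its Borel sigma-algebra. *)
Definition complex_display : measure_display.
Proof. exact: default_measure_display. Qed.

Definition complex_pair (R : realType) (z : R[i]) :
  measurableTypeR R * measurableTypeR R := (complex.Re z, complex.Im z).

Section measurable_complex.
Variable R : realType.

Let mC : set (set R[i]) := preimage_set_system setT (@complex_pair R) measurable.

Let sC : sigma_algebra setT mC.
Proof. exact/sigma_algebra_preimage/sigma_algebra_measurable. Qed.

Let mC0 : mC set0. Proof. by case: sC. Qed.

Let mCC A : mC A -> mC (~` A).
Proof. by case: sC => _ + _ => /[apply]; rewrite setTD. Qed.

Let mCU (F : (set R[i])^nat) : (forall i, mC (F i)) -> mC (\bigcup_i F i).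
Proof. by case: sC => _ _; apply. Qed.

HB.instance Definition _ :=
  @isMeasurable.Build complex_display R[i] mC mC0 mCC mCU.

End measurable_complex.

Definition matrix_display : measure_display -> measure_display.
Proof. exact. Qed.

Section measurable_matrix.
Context d (T : measurableType d) (m n : nat).

Let mM : set (set 'M[T]_(m, n)) :=
  <<s \bigcup_(ij : 'I_m * 'I_n)
        preimage_set_system setT (fun A : 'M[T]_(m, n) => A ij.1 ij.2)
          measurable >>.

Let mM0 : mM set0. Proof. exact: sigma_algebra0. Qed.
Let mMC A : mM A -> mM (~` A). Proof. exact: sigma_algebraC. Qed.
Let mMU (F : (set 'M[T]_(m, n))^nat) :
  (forall i, mM (F i)) -> mM (\bigcup_i F i).
Proof. exact: sigma_algebra_bigcup. Qed.

HB.instance Definition _ :=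
  @isMeasurable.Build (matrix_display d) 'M[T]_(m, n) mM mM0 mMC mMU.

End measurable_matrix.

Lemma sigma_finite_push_product d1 d2 d3 (T1 : measurableType d1)
    (T2 : measurableType d2) (T3 : measurableType d3) (R : realType)
    (mu : {sigma_finite_measure set T1 -> \bar R})
    (nu : {sigma_finite_measure set T2 -> \bar R})
    (f : T1 * T2 -> T3) (g : T3 -> T1 * T2) :
  measurable_fun setT g -> cancel f g ->
  sigma_finite setT (pushforward (mu \x nu)%E f).
Proof.
move=> mg fK.
have /sigma_finiteP[F [TF ndF Foo]] := sigma_finiteT mu.
have /sigma_finiteP[G [TG ndG Goo]] := sigma_finiteT nu.
exists (fun k => g @^-1` (F k `*` G k)).
  rewrite -preimage_bigcup (_ : \bigcup_k _ = setT) ?preimage_setT//.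
  rewrite -subTset => -[x y] _.
  have [i _ Fix] : (\bigcup_i F i) x by rewrite -TF.
  have [j _ Gjy] : (\bigcup_j G j) y by rewrite -TG.
  exists (maxn i j) => //; split => /=.
  - by move: x Fix; exact/subsetPset/ndF/leq_maxl.
  - by move: y Gjy; exact/subsetPset/ndG/leq_maxr.
move=> k; have [? ?] := Foo k; have [? ?] := Goo k; split.
  by rewrite -[X in measurable X]setTI; apply: mg => //; exact: measurableX.
rewrite /pushforward -comp_preimage (_ : g \o f = id) ?preimage_id.
  by rewrite product_measure1E// lte_mul_pinfty// ge0_fin_numE.
by apply/funext => p /=; exact: fK.
Qed.

Section lebesgue_complex.
Variable R : realType.
Local Open Scope ereal_scope.

Let leb : {sigma_finite_measure set (measurableTypeR R) -> \bar R} :=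
  @lebesgue_measure R.

Definition pair_complex (p : measurableTypeR R * measurableTypeR R) : R[i] :=
  p.1 +i* p.2.

Lemma measurable_complex_pair : measurable_fun setT (@complex_pair R).
Proof. by move=> _ A mA; exists A. Qed.

Lemma measurable_pair_complex : measurable_fun setT pair_complex.
Proof.
move=> _ _ [B mB <-].
rewrite !setTI -comp_preimage (_ : _ \o _ = id) ?preimage_id//.
by apply/funext => -[].
Qed.

Definition lebesgue_complex : set R[i] -> \bar R :=
  pushforward (leb \x leb) pair_complex.

Let lebesgue_complex0 : lebesgue_complex set0 = 0.
Proof.
rewrite /lebesgue_complex; apply: measure0; exact: measurable_pair_complex.
Qed.

Let lebesgue_complex_ge0 A : 0 <= lebesgue_complex A.
Proof.
rewrite /lebesgue_complex; apply: measure_ge0; exact: measurable_pair_complex.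
Qed.

Let lebesgue_complex_sigma_additive : semi_sigma_additive lebesgue_complex.
Proof.
rewrite /lebesgue_complex; apply: measure_semi_sigma_additive.
exact: measurable_pair_complex.
Qed.

HB.instance Definition _ := isMeasure.Build _ _ _ lebesgue_complex
  lebesgue_complex0 lebesgue_complex_ge0 lebesgue_complex_sigma_additive.

Let lebesgue_complex_sigma_finite : sigma_finite setT lebesgue_complex.
Proof.
by apply: sigma_finite_push_product measurable_complex_pair _ => -[].
Qed.

HB.instance Definition _ := Measure_isSigmaFinite.Build _ _ _
  lebesgue_complex lebesgue_complex_sigma_finite.

End lebesgue_complex.

(* The n-fold product of mu with itself, on n-tuples. The definition is by
   recursion, since the library only has the product of two measures. *)
Section power_measure.
Context d (T : measurableType d) (R : realType).
Local Open Scope ereal_scope.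

Definition cons_pair n (p : T * n.-tuple T) : n.+1.-tuple T :=
  [the n.+1.-tuple T of p.1 :: p.2].

Lemma measurable_cons_pair n : measurable_fun setT (@cons_pair n).
Proof. exact: measurable_cons. Qed.

Definition cons_measure n (mu : {sigma_finite_measure set T -> \bar R})
    (nu : {sigma_finite_measure set (n.-tuple T) -> \bar R}) :=
  pushforward (mu \x nu) (@cons_pair n).

Section cons_measure.
Variables (n : nat) (mu : {sigma_finite_measure set T -> \bar R})
  (nu : {sigma_finite_measure set (n.-tuple T) -> \bar R}).

Let cons_measure0 : cons_measure mu nu set0 = 0.
Proof.
rewrite /cons_measure; apply: measure0; exact: measurable_cons_pair.
Qed.

Let cons_measure_ge0 A : 0 <= cons_measure mu nu A.
Proof.
rewrite /cons_measure; apply: measure_ge0; exact: measurable_cons_pair.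
Qed.

Let cons_measure_sigma_additive : semi_sigma_additive (cons_measure mu nu).
Proof.
rewrite /cons_measure; apply: measure_semi_sigma_additive.
exact: measurable_cons_pair.
Qed.

HB.instance Definition _ := isMeasure.Build _ _ _ (cons_measure mu nu)
  cons_measure0 cons_measure_ge0 cons_measure_sigma_additive.

Let cons_measure_sigma_finite : sigma_finite setT (cons_measure mu nu).
Proof.
pose g (t : n.+1.-tuple T) : T * n.-tuple T := (thead t, [tuple of behead t]).
have mg : measurable_fun setT g.
  apply/measurable_fun_pair => /=; last exact: measurable_behead.
  exact: measurable_tnth.
apply: sigma_finite_push_product mg _ => -[x t].
by rewrite /g /=; congr pair; exact/val_inj.
Qed.

HB.instance Definition _ := Measure_isSigmaFinite.Build _ _ _
  (cons_measure mu nu) cons_measure_sigma_finite.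

End cons_measure.

Fixpoint power_measure (mu : {sigma_finite_measure set T -> \bar R}) n :
    {sigma_finite_measure set (n.-tuple T) -> \bar R} :=
  if n is n'.+1 then cons_measure mu (power_measure mu n')
  else \d_([tuple] : 0.-tuple T).

End power_measure.

Section lebesgue_matrix.
Variables (R : realType) (m n : nat).
Local Open Scope ereal_scope.

Definition tuple_mx (t : (m * n).-tuple R[i]) : 'M[R[i]]_(m, n) :=
  \matrix_(i, j) tnth t (mxvec_index i j).

Lemma measurable_tuple_mx : measurable_fun setT tuple_mx.
Proof.
apply: measurability => // _ [_ [[i j] _ [B mB <-]] <-].
rewrite !setTI (_ : _ @^-1` _ =
    (@tnth _ R[i])^~ (mxvec_index i j) @^-1` B).
  by rewrite -[X in measurable X]setTI; exact: measurable_tnth.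
by apply/seteqP; split => t /=; rewrite mxE.
Qed.

Definition lebesgue_matrix : set 'M[R[i]]_(m, n) -> \bar R :=
  pushforward (power_measure (@lebesgue_complex R) (m * n)) tuple_mx.

Let lebesgue_matrix0 : lebesgue_matrix set0 = 0.
Proof.
rewrite /lebesgue_matrix; apply: measure0; exact: measurable_tuple_mx.
Qed.

Let lebesgue_matrix_ge0 A : 0 <= lebesgue_matrix A.
Proof.
rewrite /lebesgue_matrix; apply: measure_ge0; exact: measurable_tuple_mx.
Qed.

Let lebesgue_matrix_sigma_additive : semi_sigma_additive lebesgue_matrix.
Proof.
rewrite /lebesgue_matrix; apply: measure_semi_sigma_additive.
exact: measurable_tuple_mx.
Qed.

HB.instance Definition _ := isMeasure.Build _ _ _ lebesgue_matrix
  lebesgue_matrix0 lebesgue_matrix_ge0 lebesgue_matrix_sigma_additive.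

End lebesgue_matrix.

(* f is a density of the law of X with respect to mu. Such an f is determined
   only up to a mu-null set: for pointwise statements, require in addition that
   f be continuous, which determines it everywhere for Lebesgue measure. *)
Definition has_density (R : realType) d d' (Omega : measurableType d)
    (T : measurableType d') (P : probability Omega R)
    (mu : {measure set T -> \bar R}) (X : Omega -> T) (f : T -> R) : Prop :=
  [/\ measurable_fun setT f, (forall x, 0 <= f x) &
      forall A, measurable A -> P (X @^-1` A) = (\int[mu]_(x in A) (f x)%:E)%E].

Definition mutually_independent (R : realType) d d' (Omega : measurableType d)
    (T : measurableType d') (P : probability Omega R) (I : finType)
    (X : I -> Omega -> T) : Prop :=
  forall (J : {set I}) (A : I -> set T), (forall i, measurable (A i)) ->
    P (\bigcap_(i in [set` J]) (X i @^-1` A i)) =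
    (\prod_(i in J) P (X i @^-1` A i))%E.

Definition standard_complex_gaussian (R : realType) d
    (Omega : measurableType d) (P : probability Omega R)
    (X : Omega -> R[i]) : Prop :=
  has_density P (@lebesgue_complex R) X
    (fun x => pi^-1 * expR (- (complex.Re x ^+ 2 + complex.Im x ^+ 2))).

Definition entries (R : realType) (Omega : Type) (m1 n1 m2 n2 : nat)
    (H : Omega -> 'M[R[i]]_(m1, n1)) (W : Omega -> 'M[R[i]]_(m2, n2))
    (k : 'I_m1 * 'I_n1 + 'I_m2 * 'I_n2) (w : Omega) : R[i] :=
  match k with
  | inl ij => H w ij.1 ij.2
  | inr ij => W w ij.1 ij.2
  end.

Definition argmax (R : realType) (I : Type) (f : I -> R) : set I :=
  [set l | forall k, f k <= f l].

(* Main.v *)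
Require Import Defs.
From HB Require Import structures.
From mathcomp Require Import all_boot all_order all_algebra.
From mathcomp Require Import all_classical all_reals all_analysis.
From mathcomp Require Import measurable_realfun.
From mathcomp Require Import ring lra.
From mathcomp Require Import complex spectral.

Set Implicit Arguments.
Unset Strict Implicit.
Unset Printing Implicit Defensive.
Import Order.TTheory GRing.Theory Num.Theory.
Import numFieldNormedType.Exports.

Local Open Scope classical_set_scope.
Local Open Scope ring_scope.
Local Open Scope complex_scope.
Local Open Scope sesquilinear_scope.

(** Given H, the observation is a translate of W, so its density at Y is the
    integral over H of the Gaussian density of (H, W) at (H, Y - sqrt rho S H).
    Completing the square in H splits off the factor
    exp (- tr (Y^* Y) + tr (rho Y^* S L^-1 S^* Y)), with L = I + rho S^* S, and
    leaves the Gaussian integral of tr (H^* L H), proportional to det(L)^-N.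
    The other factors do not depend on S. This computes a density that is only
    determined almost everywhere; both it and p are continuous and nonempty
    open sets have positive Lebesgue measure, so they agree at every Y. *)

(** * Integration against a power measure *)

(** Lebesgue measure on matrices is the image of a recursively built product measure on tuples, so
    every integral runs over tuples of complex numbers, and matrices enter only through algebraic
    identities. The Gaussian integral is found without any linear change of variables: by induction
    on the dimension, completing the square in the leading complex coordinate leaves a translate of
    a one-variable Gaussian times the Gaussian of the Schur complement, and the determinant factors
    in the same way. The power of the determinant comes from vectorisation: tr (H^* L H) is a
    Hermitian form in the vector of entries of H, whose matrix is the Kronecker product of L with an
    identity matrix. Translation invariance, Tonelli and the uniqueness of finite measures on boxes
    supply the remaining measure theory. *)

Section power_measure_integral.
Context d (T : measurableType d) (R : realType).
Variable mu : {sigma_finite_measure set T -> \bar R}.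
Local Open Scope ereal_scope.

Lemma integral_power_measure0 (f : 0.-tuple T -> \bar R) :
  measurable_fun [set: 0.-tuple T] f -> \int[power_measure mu 0]_t f t = f [tuple].
Proof. by move=> mf; rewrite integral_dirac// diracT mul1e. Qed.

Lemma integral_power_measureS n (f : n.+1.-tuple T -> \bar R) :
  measurable_fun setT f -> (forall t, 0 <= f t) ->
  \int[power_measure mu n.+1]_t f t =
  \int[mu]_x \int[power_measure mu n]_t f (cons_pair (x, t)).
Proof.
move=> mf f0; rewrite ge0_integral_pushforward//.
- by rewrite preimage_setT fubini_tonelli1//=;
    apply: measurableT_comp => //; exact: measurable_cons_pair.
- exact: measurable_cons_pair.
Qed.

(** The order needed when the head coordinate is to be integrated with the tail held fixed, as in
    completing the square. *)
Lemma integral_power_measureS_swap n (f : n.+1.-tuple T -> \bar R) :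
  measurable_fun setT f -> (forall t, 0 <= f t) ->
  \int[power_measure mu n.+1]_t f t =
  \int[power_measure mu n]_t \int[mu]_x f (cons_pair (x, t)).
Proof.
move=> mf f0; rewrite integral_power_measureS//.
rewrite (fubini_tonelli (fun p => f (cons_pair p)))//.
by apply: measurableT_comp => //; exact: measurable_cons_pair.
Qed.

Lemma measurable_cons_pairr n (x : T) :
  measurable_fun setT (fun t : n.-tuple T => cons_pair (x, t)).
Proof. by apply: (@measurable_cons _ _ _ _ (fun=> x) n id). Qed.

Lemma measurable_prod_tnth n (f : 'I_n -> T -> \bar R) :
  (forall i, measurable_fun setT (f i)) ->
  measurable_fun setT (fun t : n.-tuple T => \prod_i f i (tnth t i)).
Proof.
move=> mf.
elim: (index_enum _) => [|i s ih].
  by under eq_fun do rewrite big_nil; exact: measurable_cst.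
under eq_fun do rewrite big_cons.
apply: emeasurable_funM => //.
by apply: (measurableT_comp (mf i)); exact: measurable_tnth.
Qed.

Lemma tnth_cons_pair0 n (x : T) (t : n.-tuple T) :
  tnth (cons_pair (x, t)) ord0 = x.
Proof. by []. Qed.

Lemma tnth_cons_pairS n (x : T) (t : n.-tuple T) i :
  tnth (cons_pair (x, t)) (lift ord0 i) = tnth t i.
Proof. exact: tnthS. Qed.

Lemma integral_power_measure_prod n (f : 'I_n -> T -> \bar R) :
  (forall i, measurable_fun setT (f i)) -> (forall i x, 0 <= f i x) ->
  \int[power_measure mu n]_t \prod_i f i (tnth t i) =
  \prod_i \int[mu]_x f i x.
Proof.
elim: n f => [|n ih] f mf f0.
  rewrite integral_power_measure0; last exact: measurable_prod_tnth.
  by rewrite !big_ord0.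
rewrite integral_power_measureS; last 2 first.
- exact: measurable_prod_tnth.
- by move=> t; apply: prode_ge0.
under eq_integral => x _.
  under eq_integral => t _.
    rewrite big_ord_recl tnth_cons_pair0.
    under eq_bigr do rewrite tnth_cons_pairS.
    over.
  rewrite ge0_integralZl//; last 2 first.
  - by apply: (measurable_prod_tnth (fun i => mf (lift ord0 i))).
  - by move=> t _; exact: prode_ge0.
  rewrite (ih (fun i => f (lift ord0 i)))//.
  over.
rewrite ge0_integralZr// ?big_ord_recl//.
by apply: prode_ge0 => i _; exact: integral_ge0.
Qed.

Lemma measurable_cat_tuple m n :
  measurable_fun setT (fun p : m.-tuple T * n.-tuple T => cat_tuple p.1 p.2).
Proof.
apply/measurable_fun_tnthP => i; rewrite -(splitK i).
case: (fintype.split i) => j /=.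
- rewrite (_ : _ \o _ = fun p => tnth p.1 j); last first.
    by apply/funext => p; exact: (tnth_lshift p.1 p.2).
  by apply: (measurableT_comp (measurable_tnth j)).
- rewrite (_ : _ \o _ = fun p => tnth p.2 j); last first.
    by apply/funext => p; exact: (tnth_rshift p.1 p.2).
  by apply: (measurableT_comp (measurable_tnth j)).
Qed.

(** Separates the coordinates of H from those of W inside one long tuple. *)
Lemma integral_power_measureD m n (f : (m + n).-tuple T -> \bar R) :
  measurable_fun setT f -> (forall t, 0 <= f t) ->
  \int[power_measure mu (m + n)]_t f t =
  \int[power_measure mu m]_s \int[power_measure mu n]_t f (cat_tuple s t).
Proof.
have mcat k (g : (k + n).-tuple T -> \bar R) : measurable_fun setT g ->
    measurable_fun setT
      (fun p : k.-tuple T * n.-tuple T => g (cat_tuple p.1 p.2)).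
  by move=> mg; apply: (measurableT_comp mg); exact: measurable_cat_tuple.
elim: m f => [|m ih] f mf f0.
  rewrite integral_power_measure0; last first.
    apply: (measurable_fun_fubini_tonelli_F
      (fun p : 0.-tuple T * n.-tuple T => f (cat_tuple p.1 p.2))) => //.
    exact: mcat.
  by apply: eq_integral => t _; congr f; exact/val_inj.
transitivity (\int[mu]_x \int[power_measure mu m]_s
    \int[power_measure mu n]_t f (cons_pair (x, cat_tuple s t))).
  rewrite [LHS](@integral_power_measureS (m + n))//.
  apply: eq_integral => x _; apply: (ih (fun t => f (cons_pair (x, t)))) => //.
  by apply: (measurableT_comp mf); exact: measurable_cons_pairr.
rewrite [RHS](@integral_power_measureS m
  (fun s => \int[power_measure mu n]_t f (cat_tuple s t))); last 2 first.
- apply: (measurable_fun_fubini_tonelli_F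
    (fun p : m.+1.-tuple T * n.-tuple T => f (cat_tuple p.1 p.2))) => //.
  exact: mcat.
- by move=> t; exact: integral_ge0.
apply: eq_integral => x _; apply: eq_integral => s _.
apply: eq_integral => t _; congr (f _); exact/val_inj.
Qed.

(** [T] carries only a sigma-algebra, so the addition and its invariance are passed as parameters.
    The head is shifted in the outer integral, the tail by induction. *)
Lemma integral_power_measure_translation (add : T -> T -> T) n
    (c : 'I_n -> T) (f : n.-tuple T -> \bar R) :
  (forall a, measurable_fun setT (add a)) ->
  (forall a (g : T -> \bar R), measurable_fun setT g -> (forall x, 0 <= g x) ->
    \int[mu]_x g (add a x) = \int[mu]_x g x) ->
  measurable_fun setT f -> (forall t, 0 <= f t) ->
  \int[power_measure mu n]_t f [tuple add (c i) (tnth t i) | i < n] =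
  \int[power_measure mu n]_t f t.
Proof.
move=> madd addP.
have mtr k (b : 'I_k -> T) : measurable_fun setT
    (fun t : k.-tuple T => [tuple add (b i) (tnth t i) | i < k]).
  apply/measurable_fun_tnthP => i /=.
  rewrite (_ : _ \o _ = fun t => add (b i) (tnth t i)); last first.
    by apply/funext => t /=; rewrite tnth_mktuple.
  by apply: (measurableT_comp (madd (b i))); exact: measurable_tnth.
elim: n c f => [|n ih] c f mf f0.
  rewrite !integral_power_measure0//; last exact: (measurableT_comp mf (mtr _ c)).
  by congr (f _); exact: tuple0.
rewrite !integral_power_measureS//; last exact: (measurableT_comp mf (mtr _ c)).
rewrite -[RHS](addP (c ord0)); last 2 first.
- apply: (measurable_fun_fubini_tonelli_F (fun p => f (cons_pair p))) => //.
  by apply: (measurableT_comp mf); exact: measurable_cons_pair.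
- by move=> x; exact: integral_ge0.
apply: eq_integral => x _.
rewrite -[RHS](ih (fun i => c (lift ord0 i))
  (fun t => f (cons_pair (add (c ord0) x, t))))//; last first.
  by apply: (measurableT_comp mf); exact: measurable_cons_pairr.
apply: eq_integral => t _; congr f; apply: eq_from_tnth => i.
rewrite tnth_mktuple; case: (unliftP ord0 i) => [j ->|->].
  by rewrite !tnth_cons_pairS tnth_mktuple.
by rewrite !tnth_cons_pair0.
Qed.

Definition tuple_box n (A : 'I_n -> set T) : set (n.-tuple T) :=
  [set t | forall i, A i (tnth t i)].

Lemma measurable_tuple_box n (A : 'I_n -> set T) :
  (forall i, measurable (A i)) -> measurable (tuple_box A).
Proof.
move=> mA; rewrite (_ : tuple_box A =
    \bigcap_(i in [set` (@predT 'I_n)]) ((@tnth n T ^~ i) @^-1` A i)); last first.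
  by apply/seteqP; split => t At i; [move=> _|]; exact: At.
apply: fin_bigcap_measurable => // i _.
by rewrite -[X in measurable X]setTI; exact: measurable_tnth.
Qed.

(** Boxes are stable under intersection and generate the sigma-algebra on tuples. The total mass is
    finite, so the constant sequence [setT] serves as the exhaustion. *)
Lemma tuple_measure_unique n (m1 m2 : {measure set (n.-tuple T) -> \bar R}) :
  m1 setT < +oo ->
  (forall A : 'I_n -> set T, (forall i, measurable (A i)) ->
    m1 (tuple_box A) = m2 (tuple_box A)) ->
  forall B, measurable B -> m1 B = m2 B.
Proof.
move=> m1oo m12.
pose G := [set @tuple_box n A | A in [set A | forall i, measurable (A i)]].
have GT : G setT.
  by exists (fun=> setT) => //; apply/seteqP; split.
apply: (measure_unique G (fun=> setT)) => //.
- rewrite eqEsubset; split.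
    apply: smallest_sub; first exact: smallest_sigma_algebra.
    rewrite -bigcup_seq => _ [i _ [A mA <-]].
    apply: sub_sigma_algebra; rewrite setTI.
    (* A generating cylinder is a box with a constraint on a single coordinate. *)
    exists (fun j => if j == i then A else setT).
      by move=> j; case: ifP.
    apply/seteqP; split => t /=.
      by move=> /(_ i); rewrite eqxx.
    by move=> At j; case: eqP => // ->.
  apply: smallest_sub; first exact: sigma_algebra_measurable.
  by move=> _ [A mA <-]; exact: measurable_tuple_box.
- move=> _ _ [A mA <-] [B mB <-]; exists (fun i => A i `&` B i).
    by move=> i; exact: measurableI.
  apply/seteqP; split => t /=.
    by move=> AB; split => i; have [] := AB i.
  by move=> [tA tB] i; split; [exact: tA|exact: tB].
- by rewrite bigcup_const.
- by move=> _ [A mA <-]; exact: m12.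
Qed.

End power_measure_integral.

(** * Joint density of independent variables *)

Section density_measure.
Context d (T : measurableType d) (R : realType).
Variables (mu : {measure set T -> \bar R}) (f : T -> \bar R).
Hypotheses (mf : measurable_fun setT f) (f0 : forall x, (0 <= f x)%E).
Local Open Scope ereal_scope.

(** The two proofs are arguments of the definition so that the measure structure declared below can
    be recovered from the term alone. *)
Definition density_measure of measurable_fun setT f & (forall x, 0 <= f x) :=
  fun A : set T => \int[mu]_(x in A) f x.
Local Notation nu := (density_measure mf f0).

Let density_measure0 : nu set0 = 0.
Proof. by rewrite /density_measure integral_set0. Qed.

Let density_measure_ge0 A : 0 <= nu A.
Proof. exact: integral_ge0. Qed.

Let density_measure_sigma_additive : semi_sigma_additive nu.
Proof.
move=> F mF tF mUF; rewrite /density_measure ge0_integral_bigcup//; last first.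
  exact: measurable_funTS.
apply: is_cvg_ereal_nneg_natsum_cond => n _ _; exact: integral_ge0.
Qed.

HB.instance Definition _ := isMeasure.Build _ _ _ nu
  density_measure0 density_measure_ge0 density_measure_sigma_additive.

End density_measure.

(** Both sides are measures in [B], the left one finite. On boxes, independence splits the left side
    and Tonelli the right side into the same product. *)
Lemma has_density_tuple (R : realType) d d' (Omega : measurableType d)
    (T : measurableType d') (P : probability Omega R)
    (mu : {sigma_finite_measure set T -> \bar R}) n
    (Z : 'I_n -> Omega -> T) (g : T -> R) :
  (forall i, measurable_fun setT (Z i)) ->
  (forall i, has_density P mu (Z i) g) ->
  measurable_fun setT g -> (forall x, 0 <= g x) ->
  (forall A : 'I_n -> set T, (forall i, measurable (A i)) ->
    P (\bigcap_i (Z i @^-1` A i)) = (\prod_i P (Z i @^-1` A i))%E) ->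
  forall B, measurable B ->
  P ((fun w => [tuple Z i w | i < n]) @^-1` B) =
  (\int[power_measure mu n]_(t in B) \prod_i (g (tnth t i))%:E)%E.
Proof.
move=> mZ gZ mg g0 indep.
have mZt : measurable_fun setT (fun w => [tuple Z i w | i < n]).
  apply/measurable_fun_tnthP => i; rewrite (_ : _ \o _ = Z i)//.
  by apply/funext => w /=; rewrite tnth_mktuple.
pose f (t : n.-tuple T) := (\prod_i (g (tnth t i))%:E)%E.
have mf : measurable_fun [set: n.-tuple T] f.
  apply: (measurable_prod_tnth (f := fun i x => (g x)%:E)) => i.
  exact/measurable_EFinP.
have f0 t : (0 <= f t)%E by apply: prode_ge0 => i _; rewrite lee_fin.
apply: (@tuple_measure_unique _ T R n (pushforward P _)
  (density_measure (power_measure mu n) mf f0)).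
- by rewrite -[X in (X < _)%E]/(P setT) probability_setT ltry.
move=> A mA; rewrite -[LHS]/(P (_ @^-1` _)).
rewrite (_ : _ @^-1` _ = \bigcap_i (Z i @^-1` A i)); last first.
  apply/seteqP; split => [w + i _|w ZA i] /=.
    by move=> /(_ i); rewrite tnth_mktuple.
  by rewrite tnth_mktuple; exact: ZA.
rewrite indep// /= /density_measure integral_mkcond.
(* Restricting a product to a box restricts each factor: off the box, some restricted factor
   vanishes. *)
rewrite (_ : f \_ _ =
    fun t => (\prod_i ((EFin \o g) \_ (A i)) (tnth t i))%E); last first.
  apply/funext => t; rewrite patchE; case: ifPn => [|/negP].
    rewrite inE => At; apply: eq_bigr => i _.
    by rewrite patchE mem_set//; exact: At.
  rewrite inE => /existsNP[i Ai].
  by rewrite (bigD1 i)//= patchE memNset// mul0e.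
rewrite (@integral_power_measure_prod _ _ _ mu n
  (fun i => (EFin \o g) \_ (A i))); last 2 first.
- move=> i; apply/(measurable_restrictT _ (mA i)) => //.
  by apply: measurable_funTS; exact/measurable_EFinP.
- by move=> i x; rewrite patchE; case: ifP => //= _; rewrite lee_fin.
apply: eq_bigr => i _; have [_ _ ->] := gZ i; last exact: mA.
by rewrite integral_mkcond.
Qed.

(** * Measurability and continuity of complex matrix expressions *)

Section function_algebra.
Variables (R : realType) (X : Type) (C : (X -> R) -> Prop).

(* Measurable and continuous real functions are the two instances; they spare
   a separate treatment of complex matrix expressions for each notion. *)
Definition function_algebra : Prop :=
  [/\ forall a, C (fun=> a),
      forall f g, C f -> C g -> C (fun x => f x + g x) &
      forall f g, C f -> C g -> C (fun x => f x * g x)].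

Definition complex_in (f : X -> R[i]) : Prop :=
  C (fun x => complex.Re (f x)) /\ C (fun x => complex.Im (f x)).

Definition mx_in m n (F : X -> 'M[R[i]]_(m, n)) : Prop :=
  forall i j, complex_in (fun x => F x i j).

Hypothesis CA : function_algebra.

Lemma complex_in_cst a : complex_in (fun=> a).
Proof. by case: CA => Cc _ _; split; exact: Cc. Qed.

Lemma complex_inD f g : complex_in f -> complex_in g ->
  complex_in (fun x => f x + g x).
Proof.
case: CA => _ CD _ [fr fi] [gr gi]; split.
- by under eq_fun do rewrite raddfD; exact: CD.
- by under eq_fun do rewrite raddfD; exact: CD.
Qed.

Lemma Re_mul (z w : R[i]) : complex.Re (z * w) =
  complex.Re z * complex.Re w - complex.Im z * complex.Im w.
Proof. by case: z w => [a b] [c e]. Qed.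

Lemma Im_mul (z w : R[i]) : complex.Im (z * w) =
  complex.Re z * complex.Im w + complex.Im z * complex.Re w.
Proof. by case: z w => [a b] [c e]. Qed.

Lemma function_algebraN f : C f -> C (fun x => - f x).
Proof.
case: CA => Cc _ CM Cf; under eq_fun do rewrite -mulN1r.
exact: (CM (fun=> -1)).
Qed.

Lemma complex_inM f g : complex_in f -> complex_in g ->
  complex_in (fun x => f x * g x).
Proof.
case: CA => _ CD CM [fr fi] [gr gi]; split.
- under eq_fun do rewrite Re_mul.
  by apply: CD; [|apply: function_algebraN]; exact: CM.
- by under eq_fun do rewrite Im_mul; apply: CD; exact: CM.
Qed.

Lemma Re_conj (z : R[i]) : complex.Re (Num.conj z) = complex.Re z.
Proof. by case: z. Qed.

Lemma Im_conj (z : R[i]) : complex.Im (Num.conj z) = - complex.Im z.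
Proof. by case: z. Qed.

Lemma complex_in_conj f : complex_in f -> complex_in (fun x => Num.conj (f x)).
Proof.
move=> [fr fi]; split; first by under eq_fun do rewrite Re_conj.
by under eq_fun do rewrite Im_conj; exact: function_algebraN.
Qed.

Lemma complex_in_sum (I : finType) (f : I -> X -> R[i]) :
  (forall i, complex_in (f i)) -> complex_in (fun x => \sum_i f i x).
Proof.
move=> Cf; elim: (index_enum I) => [|i s ih].
  by under eq_fun do rewrite big_nil; exact: complex_in_cst.
by under eq_fun do rewrite big_cons; exact: complex_inD.
Qed.

Lemma mx_in_cst m n (A : 'M[R[i]]_(m, n)) : mx_in (fun=> A).
Proof. by move=> i j; exact: complex_in_cst. Qed.

Lemma mx_inD m n (F G : X -> 'M[R[i]]_(m, n)) :
  mx_in F -> mx_in G -> mx_in (fun x => F x + G x).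
Proof.
by move=> CF CG i j; under eq_fun do rewrite mxE; exact: complex_inD.
Qed.

Lemma mx_inM m n p (F : X -> 'M[R[i]]_(m, n)) (G : X -> 'M[R[i]]_(n, p)) :
  mx_in F -> mx_in G -> mx_in (fun x => F x *m G x).
Proof.
move=> CF CG i j; under eq_fun do rewrite mxE.
by apply: complex_in_sum => k; exact: complex_inM.
Qed.

Lemma mx_in_adjoint m n (F : X -> 'M[R[i]]_(m, n)) :
  mx_in F -> mx_in (fun x => (F x)^t*).
Proof.
by move=> CF i j; under eq_fun do rewrite !mxE; exact: complex_in_conj.
Qed.

Lemma complex_in_trace n (F : X -> 'M[R[i]]_n) :
  mx_in F -> complex_in (fun x => \tr (F x)).
Proof. by move=> CF; exact: complex_in_sum. Qed.

End function_algebra.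

Section measurable_complex_function.
Context d (T : measurableType d) (R : realType).

Lemma measurable_function_algebra :
  function_algebra (fun f : T -> R => measurable_fun setT f).
Proof.
by split=> [a|f g|f g]; [exact: measurable_cst|exact: measurable_funD|
  exact: measurable_funM].
Qed.

Lemma measurable_complexP (f : T -> R[i]) : measurable_fun setT f <->
  complex_in (fun g : T -> R => measurable_fun setT g) f.
Proof.
split=> [mf|[mr mi]].
  have mp := measurableT_comp (@measurable_complex_pair R) mf.
  by split; [exact: (measurableT_comp measurable_fst mp)|
    exact: (measurableT_comp measurable_snd mp)].
rewrite (_ : f = @pair_complex R \o
    (fun x => (complex.Re (f x), complex.Im (f x)))); last first.
  by apply/funext => x /=; rewrite /pair_complex/=; case: (f x).
apply: measurableT_comp; first exact: measurable_pair_complex.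
exact/measurable_fun_pair.
Qed.

Lemma measurable_mxP m n (F : T -> 'M[R[i]]_(m, n)) : measurable_fun setT F <->
  mx_in (fun g : T -> R => measurable_fun setT g) F.
Proof.
split=> [mF i j|mF].
  apply/measurable_complexP.
  move=> _ B mB; rewrite setTI.
  rewrite (_ : _ @^-1` _ = F @^-1` ((fun A => A i j) @^-1` B))//.
  rewrite -[X in measurable X]setTI; apply: mF => //.
  by apply: sub_sigma_algebra; exists (i, j) => //; exists B => //; rewrite setTI.
apply: measurability => // _ [_ [[i j] _ [B mB <-]] <-].
rewrite !setTI -[X in measurable X]setTI.
have /measurable_complexP mij := mF i j.
exact: mij.
Qed.

End measurable_complex_function.

(** * Translation invariance and one-variable Gaussian integrals *)

Section lebesgue_translation.
Variable R : realType.
Local Open Scope ereal_scope.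
Local Notation mu := (@lebesgue_measure R).

(** By uniqueness of Lebesgue measure, half-open intervals suffice, and a shift preserves their
    length. *)
Lemma lebesgue_measure_translation (c : R) (A : set R) : measurable A ->
  pushforward mu (+%R c : _ -> measurableTypeR R) A = mu A.
Proof.
move=> mA; apply/esym/lebesgue_measure_unique => //=.
  by apply: measurable_funD.
move=> _ _ [[a b]] _ <-.
rewrite /pushforward (_ : _ @^-1` _ = `](a - c)%R, (b - c)%R]%classic); last first.
  by apply/seteqP; split => x /=; rewrite !in_itv/= ltrBlDl lerBrDl.
rewrite !lebesgue_measure_itv/= !lte_fin ltrD2r.
by case: ifP => // _; rewrite -!EFinB; congr (_%:E); ring.
Qed.

Lemma integral_lebesgue_translation (c : R) (f : R -> \bar R) :
  measurable_fun setT f -> (forall x, 0 <= f x) ->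
  \int[mu]_x f (c + x)%R = \int[mu]_x f x.
Proof.
move=> mf f0.
have mc : measurable_fun setT (+%R c : measurableTypeR R -> measurableTypeR R).
  exact: measurable_funD.
rewrite -[LHS](@ge0_integral_pushforward _ _ _ _ _ _ mc mu setT)//.
by apply: eq_measure_integral => //= A mA AS; exact: lebesgue_measure_translation.
Qed.

Lemma integral_lebesgue_complex (f : R[i] -> \bar R) :
  measurable_fun setT f -> (forall z, 0 <= f z) ->
  \int[@lebesgue_complex R]_z f z = \int[mu]_x \int[mu]_y f (x +i* y)%C.
Proof.
move=> mf f0; rewrite ge0_integral_pushforward//.
- rewrite preimage_setT fubini_tonelli1//=.
  by apply: measurableT_comp => //; exact: measurable_pair_complex.
- exact: measurable_pair_complex.
Qed.

Lemma measurable_pair_complexr (x : R) :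
  measurable_fun setT (fun y : measurableTypeR R => (x +i* y)%C).
Proof.
apply: (@measurableT_comp _ _ _ _ _ _ (@pair_complex R) _ (fun y => (x, y))).
  exact: measurable_pair_complex.
exact/measurable_fun_pair.
Qed.

Lemma integral_lebesgue_complex_translation (c : R[i]) (f : R[i] -> \bar R) :
  measurable_fun setT f -> (forall z, 0 <= f z) ->
  \int[@lebesgue_complex R]_z f (c + z)%R = \int[@lebesgue_complex R]_z f z.
Proof.
case: c => c1 c2 mf f0.
rewrite !integral_lebesgue_complex//; last first.
  apply: (measurableT_comp mf); apply/measurable_complexP.
  have CA := measurable_function_algebra (R[i] : measurableType _) R.
  apply: (complex_inD CA); first exact: complex_in_cst.
  by apply/measurable_complexP.
rewrite -[RHS](integral_lebesgue_translation c1); last 2 first.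
- apply: (measurable_fun_fubini_tonelli_F (fun p => f (pair_complex p))) => //.
  by apply: measurableT_comp => //; exact: measurable_pair_complex.
- by move=> x; exact: integral_ge0.
apply: eq_integral => x _.
rewrite -[RHS](integral_lebesgue_translation c2)//.
by apply: measurableT_comp => //; exact: measurable_pair_complexr.
Qed.

(** Read off from the total mass 1 of the centred normal density. *)
Lemma integral_gaussM (a : R) : (0 < a)%R ->
  \int[mu]_x (expR (- (a * x ^+ 2)))%:E = (Num.sqrt (pi / a))%:E.
Proof.
move=> a0.
(* The standard deviation for which x^2 / (2 s^2) equals a x^2. *)
pose s : R := Num.sqrt (2 * a)^-1.
have a20 : (0 < (2 * a)^-1 :> R)%R by rewrite invr_gt0 mulr_gt0.
have s0 : s != 0%R by rewrite gt_eqF// sqrtr_gt0.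
have s2 : (s ^+ 2 = (2 * a)^-1)%R by rewrite sqr_sqrtr// ltW.
have := integral_normal_pdf 0 s.
rewrite normal_pdfE//.
rewrite (_ : normal_peak s = (Num.sqrt (pi / a))^-1)%R; last first.
  rewrite /normal_peak s2; congr (Num.sqrt _)^-1%R.
  by rewrite -mulr_natl; field; rewrite gt_eqF.
under eq_integral => x _.
  rewrite (_ : normal_fun 0 s x = expR (- (a * x ^+ 2)))%R; last first.
    rewrite /normal_fun subr0 s2; congr expR.
    by rewrite -mulr_natl; field; rewrite gt_eqF.
  rewrite EFinM; over.
have mE : measurable_fun setT (fun x : R => (expR (- (a * x ^+ 2)))%:E).
  apply/measurable_EFinP; apply: measurableT_comp => //.
  by apply: measurableT_comp => //; apply: measurable_funM => //; exact: measurable_funX.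
rewrite ge0_integralZl//.
have sp : (0 < Num.sqrt (pi / a) :> R)%R by rewrite sqrtr_gt0 divr_gt0// pi_gt0.
move=> /(congr1 (fun x => (Num.sqrt (pi / a))%:E * x)).
by rewrite muleA -EFinM divff ?gt_eqF// mul1e mule1.
Qed.

Lemma integral_complex_gauss (a : R) : (0 < a)%R ->
  \int[@lebesgue_complex R]_z
    (expR (- (a * (complex.Re z ^+ 2 + complex.Im z ^+ 2))))%:E = (pi / a)%:E.
Proof.
move=> a0; have [mRe mIm] := (measurable_complexP (@id R[i])).1 (@measurable_id _ _ setT).
rewrite integral_lebesgue_complex; last 2 first.
- apply/measurable_EFinP; apply: measurableT_comp => //.
  apply: measurableT_comp => //; apply: measurable_funM => //.
  by apply: measurable_funD; exact: measurable_funX.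
- by move=> z; rewrite lee_fin expR_ge0.
have mE : measurable_fun setT (fun x : R => (expR (- (a * x ^+ 2)))%:E).
  apply/measurable_EFinP; apply: measurableT_comp => //.
  by apply: measurableT_comp => //; apply: measurable_funM => //; exact: measurable_funX.
under eq_integral => x _.
  under eq_integral => y _ do rewrite /= mulrDr opprD expRD EFinM.
  rewrite ge0_integralZl//.
  rewrite integral_gaussM//.
  over.
rewrite ge0_integralZr//.
rewrite integral_gaussM// -EFinM -expr2 sqr_sqrtr// divr_ge0//.
  exact: pi_ge0.
exact: ltW.
Qed.

End lebesgue_translation.

(** * Positive definite matrices *)

Section positive_definite.
Variable C : numClosedFieldType.

Definition form n (Q : 'M[C]_n) (v : 'rV[C]_n) : C := (v *m Q *m v^t*) 0 0.

(** In the order of [C], a positive element is real, so the second clause also asserts that the form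
    takes real values. *)
Definition posdef n (Q : 'M[C]_n) : Prop :=
  Q^t* = Q /\ forall v, v != 0 -> 0 < form Q v.

Lemma adjmxM m n p (A : 'M[C]_(m, n)) (B : 'M[C]_(n, p)) :
  (A *m B)^t* = B^t* *m A^t*.
Proof. by rewrite trmx_mul map_mxM. Qed.

Lemma adjmxD m n (A B : 'M[C]_(m, n)) : (A + B)^t* = A^t* + B^t*.
Proof. by rewrite linearD map_mxD. Qed.

Lemma adjmxZ m n a (A : 'M[C]_(m, n)) : (a *: A)^t* = Num.conj a *: A^t*.
Proof. by rewrite linearZ map_mxZ. Qed.

Lemma adjmx1 n : (1%:M : 'M[C]_n)^t* = 1%:M.
Proof. by rewrite trmx1 map_mx1. Qed.

Lemma form1 n (v : 'rV[C]_n) : v != 0 -> 0 < form 1%:M v.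
Proof.
move=> v0; rewrite /form mulmx1 mxE.
have [i vi] : exists i, v 0 i != 0.
  apply/existsP; apply: contraNT v0; rewrite negb_exists => /forallP v0.
  by apply/eqP/rowP => i; rewrite mxE; apply/eqP/negPn/v0.
rewrite (bigD1 i)//= ltr_wpDr//.
  by apply: sumr_ge0 => j _; rewrite !mxE mul_conjC_ge0.
by rewrite !mxE mul_conjC_gt0.
Qed.

Lemma form1_ge0 n (v : 'rV[C]_n) : 0 <= form 1%:M v.
Proof.
by rewrite /form mulmx1 mxE sumr_ge0// => j _; rewrite !mxE mul_conjC_ge0.
Qed.

(** The Gram part contributes [r] times the squared norm of v A^*, added to the positive squared
    norm of v. *)
Lemma posdef_1D_gram m n (r : C) (A : 'M[C]_(m, n)) : 0 <= r ->
  posdef (1%:M + r *: (A^t* *m A)).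
Proof.
move=> r0; split.
  by rewrite adjmxD adjmx1 adjmxZ adjmxM trmxCK geC0_conj.
move=> v v0; rewrite /form mulmxDr mulmxDl mxE ltr_pwDl//; first exact: form1.
rewrite -scalemxAr -scalemxAl mxE mulr_ge0//.
have := form1_ge0 (v *m A^t*).
by rewrite /form mulmx1 adjmxM trmxCK !mulmxA.
Qed.

(** * Schur complement of the leading entry *)

Section schur.
Variables (n : nat) (Q : 'M[C]_(1 + n)).
Hypothesis Q_pos : posdef Q.

Definition pivot : C := Q 0 0.

Definition schur : 'M[C]_n :=
  drsubmx Q - pivot^-1 *: (dlsubmx Q *m ursubmx Q).

Lemma form_delta m (A : 'M[C]_m) i : form A (delta_mx 0 i) = A i i.
Proof.
rewrite /form -rowE mxE (bigD1 i)//= big1 => [|j ji].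
  by rewrite !mxE !eqxx conjC1 mulr1 addr0.
by rewrite !mxE (negbTE ji) andbF conjC0 mulr0.
Qed.

Lemma pivot_gt0 : 0 < pivot.
Proof.
rewrite /pivot -form_delta; case: Q_pos => _; apply.
by apply/eqP => /rowP/(_ 0); rewrite !mxE !eqxx => /eqP; rewrite oner_eq0.
Qed.

Lemma ulsubmx_pivot : ulsubmx Q = pivot%:M.
Proof.
rewrite [LHS]mx11_scalar; congr (_%:M); rewrite !mxE /pivot.
by congr (Q _ _); exact/val_inj.
Qed.

Lemma ursubmx_adj : ursubmx Q = (dlsubmx Q)^t*.
Proof.
have [/matrixP QQ _] := Q_pos; apply/matrixP => i j.
by rewrite !mxE -QQ !mxE.
Qed.

(** One step of block Gaussian elimination; the left factor is unipotent, so the determinant is that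
    of the right one. *)
Lemma schur_decomposition :
  Q = block_mx 1%:M 0 (pivot^-1 *: dlsubmx Q) 1%:M *m
      block_mx pivot%:M (ursubmx Q) 0 schur.
Proof.
rewrite mulmx_block !mul1mx !mul0mx !addr0.
rewrite -scalemxAl mul_mx_scalar scalerA mulVf ?gt_eqF ?pivot_gt0// scale1r.
by rewrite -scalemxAl /schur addrC subrK -ulsubmx_pivot submxK.
Qed.

Lemma det_schur : \det Q = pivot * \det schur.
Proof.
rewrite schur_decomposition det_mulmx det_lblock !det1 !mul1r.
by rewrite det_ublock det_scalar1.
Qed.

(* Completing the square in the first variable. *)
Lemma form_schur (x : C) (v : 'rV[C]_n) :
  let z := (v *m dlsubmx Q) 0 0 / pivot + x in
  form Q (row_mx x%:M v) = pivot * (z * Num.conj z) + form schur v.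
Proof.
rewrite /=; set s := (v *m dlsubmx Q) 0 0; set z := _ + x.
have vc : v *m dlsubmx Q = s%:M by rewrite [LHS]mx11_scalar.
have bv : ursubmx Q *m v^t* = (Num.conj s)%:M.
  by rewrite ursubmx_adj -adjmxM vc tr_scalar_mx map_scalar_mx.
have p0 : pivot != 0 by rewrite gt_eqF ?pivot_gt0.
have pr : Num.conj pivot = pivot by rewrite geC0_conj// ltW ?pivot_gt0.
have -> : form schur v = (v *m drsubmx Q *m v^t*) 0 0 - pivot^-1 * (s * Num.conj s).
  rewrite /form /schur mulmxBr mulmxBl -scalemxAr -scalemxAl !mulmxA vc.
  by rewrite -(mulmxA s%:M) bv -scalar_mxM !mxE eqxx mulr1n.
rewrite /form -{1}[Q]submxK mul_row_block tr_row_mx map_col_mx mul_row_col.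
rewrite ulsubmx_pivot vc -scalar_mxM -raddfD/= mulmxDl -mulmxA bv.
rewrite tr_scalar_mx map_scalar_mx -!scalar_mxM !mxE eqxx !mulr1n.
rewrite /z rmorphD rmorphM fmorphV /= pr.
by field.
Qed.

Lemma posdef_schur : posdef schur.
Proof.
have p0 := pivot_gt0.
have pr : Num.conj pivot^-1 = pivot^-1.
  by rewrite geC0_conj// invr_ge0 ltW.
split.
  rewrite /schur linearB/= map_mxB; congr (_ - _).
    have [/matrixP QQ _] := Q_pos; apply/matrixP => i j.
    by rewrite !mxE -[RHS]QQ !mxE.
  by rewrite adjmxZ pr adjmxM ursubmx_adj trmxCK.
(* This [x] makes the completed square vanish, so the Schur form at [v] is a value of the form of
   [Q] at a nonzero vector. *)
move=> v v0; pose x := - ((v *m dlsubmx Q) 0 0 / pivot).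
have := form_schur x v; rewrite /= subrr mul0r mulr0 add0r => <-.
case: Q_pos => _; apply; apply: contraNneq v0 => xv0.
by rewrite -(row_mxKr x%:M v) xv0 linear0.
Qed.

End schur.

(** Turns the trace form on matrices into a sesquilinear form on their vectorisations, so that
    matrix Gaussian integrals become integrals over row vectors. *)
Lemma form_lin_mulmx m n (A : 'M[C]_m) (V W : 'M[C]_(m, n)) :
  (mxvec V *m lin_mulmx A *m (mxvec W)^t*) 0 0 = \tr (W^t* *m A *m V).
Proof.
rewrite mul_vec_lin mxE /= (reindex _ (curry_mxvec_bij _ _))/=.
transitivity (\sum_i \sum_j mxvec (A *m V) 0 (mxvec_index i j) *
    (mxvec W)^t* (mxvec_index i j) 0).
  by rewrite pair_bigA /=; apply: eq_bigr => -[i j] _.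
rewrite exchange_big /mxtrace; apply: eq_bigr => j _.
rewrite -mulmxA [RHS]mxE; apply: eq_bigr => i _.
by rewrite mxvecE [X in _ * X]mxE [X in _ * Num.conj X]mxE mxvecE mulrC !mxE.
Qed.

Lemma adjmx_eq m (Q : 'M[C]_m) :
  (forall v w : 'rV_m, (v *m Q *m w^t*) 0 0 = Num.conj ((w *m Q *m v^t*) 0 0)) ->
  Q^t* = Q.
Proof.
have E (B : 'M[C]_m) i j :
    ((delta_mx 0 i : 'rV_m) *m B *m (delta_mx 0 j : 'rV_m)^t*) 0 0 = B i j.
  rewrite -rowE mxE (bigD1 j)//= big1 => [|k kj].
    by rewrite !mxE !eqxx conjC1 mulr1 addr0.
  by rewrite !mxE (negbTE kj) andbF conjC0 mulr0.
move=> QE; apply/matrixP => i j; rewrite -[RHS]E QE E !mxE; reflexivity.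
Qed.

(** The trace of V^* A V is a sum of values of the form of [A], one per column of [V], and a nonzero
    [V] has a nonzero column. *)
Lemma posdef_lin_mulmx m n (A : 'M[C]_m) :
  posdef A -> posdef (lin_mulmx A : 'M[C]_(m * n)).
Proof.
move=> [AA Apos]; split.
  apply: adjmx_eq => v w; rewrite -(vec_mxK v) -(vec_mxK w) !form_lin_mulmx.
  by rewrite -[in RHS]mxtrace_tr -trace_map_mx !adjmxM AA trmxCK mulmxA.
move=> v v0; rewrite /form -(vec_mxK v) form_lin_mulmx.
set V := vec_mx v.
have V0 : V^t* != 0.
  apply: contra_neq v0 => V0; rewrite -(vec_mxK v) -/V -(trmxCK V) V0.
  by rewrite trmx0 map_mx0 linear0.
have tE : \tr (V^t* *m A *m V) = \sum_j form A (row j (V^t*)).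
  apply: eq_bigr => j _; rewrite /form -row_mul mxE [RHS]mxE.
  by apply: eq_bigr => k _; rewrite !mxE conjCK.
have ge0 u : 0 <= form A u.
  have [->|/Apos/ltW//] := eqVneq u 0.
  by rewrite /form !mul0mx mxE.
have [j Vj] : exists j, row j (V^t*) != 0.
  apply/existsP; apply: contraNT V0; rewrite negb_exists => /forallP V0.
  by apply/eqP/row_matrixP => j; rewrite row0; apply/eqP/negPn/V0.
by rewrite tE (bigD1 j)//= ltr_pwDl ?sumr_ge0// Apos.
Qed.

(* lin_mulmx A represents the Kronecker product of A and the identity. *)
Lemma det_lin_mulmx m n (A : 'M[C]_m) : posdef A ->
  \det (lin_mulmx A : 'M[C]_(m * n)) = \det A ^+ n.
Proof.
move=> [AA _].
have linM (X Y : 'M[C]_m) : (lin_mulmx (X *m Y) : 'M[C]_(m * n)) =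
    lin_mulmx Y *m lin_mulmx X.
  apply/row_matrixP => k; rewrite !rowE mulmxA !mul_rV_lin mxvecK.
  by rewrite /= mulmxA.
have lin1 : (lin_mulmx 1%:M : 'M[C]_(m * n)) = 1%:M.
  by apply/row_matrixP => k; rewrite !rowE mul_rV_lin /= mul1mx vec_mxK mulmx1.
(* A Hermitian matrix is normal, hence diagonalisable. Conjugation by [P] drops out of both
   determinants, and in the diagonal case each eigenvalue occurs [n] times. *)
have /normalmxP/orthomx_spectralP : A *m A^t* = A^t* *m A by rewrite AA.
set P := spectralmx A; set sp := spectral_diag A => AE.
have Pu : P \in unitmx by exact: spectral_unit.
have lind : lin_mulmx (diag_mx sp) =
    diag_mx (mxvec (\matrix_(i < m, j < n) sp 0 i)) :> 'M[C]_(m * n).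
  apply/row_matrixP => k; rewrite !rowE mul_rV_lin /= mul_diag_mx mul_mx_diag.
  apply/rowP => l; case/mxvec_indexP: l => i j; rewrite mxvecE !mxE mxvecE !mxE.
  by rewrite mulrC.
rewrite {1}AE !linM !det_mulmx mulrCA -det_mulmx -linM mulVmx// lin1 det1 mulr1.
rewrite AE !det_mulmx mulrAC -det_mulmx mulVmx// det1 mul1r lind !det_diag.
rewrite (reindex _ (curry_mxvec_bij _ _))/=.
transitivity (\prod_i \prod_j mxvec (\matrix_(i < m, j < n) sp 0 i) 0
    (mxvec_index i j)).
  by rewrite pair_bigA /=; apply: eq_bigr => -[i j] _.
rewrite -prodrXl; apply: eq_bigr => i _.
under eq_bigr do rewrite mxvecE mxE.
by rewrite prodr_const card_ord.
Qed.

End positive_definite.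

(** * Gaussian integrals *)

Section gaussian_integral.
Variable R : realType.

Definition tuple_row n (t : n.-tuple R[i]) : 'rV[R[i]]_n := \row_k tnth t k.

Lemma tuple_row_cons n (x : R[i]) (t : n.-tuple R[i]) :
  tuple_row (cons_pair (x, t)) = row_mx x%:M (tuple_row t) :> 'rV_(1 + n).
Proof.
apply/rowP => k; rewrite mxE; case: (split_ordP k) => j ->.
  rewrite row_mxEl ord1 mxE mulr1n -[RHS](tnth_cons_pair0 x t).
  by congr tnth; exact/val_inj.
rewrite row_mxEr mxE -[RHS](tnth_cons_pairS x).
by congr tnth; exact/val_inj.
Qed.

Lemma mxvec_tuple_mx m n (t : (m * n).-tuple R[i]) :
  mxvec (tuple_mx t) = tuple_row t.
Proof. by apply/rowP => k; case/mxvec_indexP: k => i j; rewrite mxvecE !mxE. Qed.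

Lemma measurable_tuple_row n :
  mx_in (fun g : n.-tuple R[i] -> R => measurable_fun setT g) (@tuple_row n).
Proof.
move=> i j; rewrite (_ : (fun _ => _) = (@tnth n R[i])^~ j); last first.
  by apply/funext => t; rewrite mxE.
by apply/measurable_complexP; exact: measurable_tnth.
Qed.

Lemma measurable_expR_Re d (T : measurableType d) (f : T -> R[i]) :
  complex_in (fun g : T -> R => measurable_fun setT g) f ->
  measurable_fun setT (fun x => expR (- complex.Re (f x))).
Proof.
by move=> [mf _]; apply: measurableT_comp => //; exact: measurableT_comp.
Qed.

Lemma measurable_form d (T : measurableType d) n (Q : 'M[R[i]]_n)
    (F : T -> 'rV[R[i]]_n) :
  mx_in (fun g : T -> R => measurable_fun setT g) F ->
  measurable_fun setT (fun x => expR (- complex.Re (form Q (F x)))).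
Proof.
move=> mF; apply: measurable_expR_Re.
have CA := measurable_function_algebra T R.
apply: (mx_inM CA); last exact: mx_in_adjoint.
by apply: (mx_inM CA) => //; exact: mx_in_cst.
Qed.

(** The determinant is complex and the integral real. Carrying the real number [e] through the
    induction also proves that the determinant is real and positive. *)
Lemma integral_gauss_centered n (Q : 'M[R[i]]_n) : posdef Q ->
  exists2 e : R, 0 < e & \det Q = e%:C /\
    (\int[power_measure (@lebesgue_complex R) n]_t
      (expR (- complex.Re (form Q (tuple_row t))))%:E)%E = (pi ^+ n / e)%:E.
Proof.
elim: n Q => [|n ih] Q Qpos.
  exists 1 => //; split; first by rewrite det_mx00.
  rewrite integral_power_measure0; last first.
    by apply/measurable_EFinP/measurable_form; exact: measurable_tuple_row.
  by rewrite /form mxE big_ord0 oppr0 expR0 expr0 divr1.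
have [e e0 [detE intE]] := ih _ (posdef_schur Qpos).
have := pivot_gt0 Qpos; case pE : (pivot (Q : 'M[R[i]]_(1 + n))) => [a b].
rewrite ltcE/= => /andP[/eqP b0 a0]; rewrite {}b0 in pE.
exists (a * e); first exact: mulr_gt0.
split.
  rewrite (det_schur Qpos) pE detE; apply/eqP; rewrite eq_complex /=.
  by rewrite !mulr0 mul0r subr0 addr0 !eqxx.
rewrite integral_power_measureS_swap; last 2 first.
- by apply/measurable_EFinP/measurable_form; exact: measurable_tuple_row.
- by move=> t; rewrite lee_fin expR_ge0.
pose sq (z : R[i]) := expR (- (a * (complex.Re z ^+ 2 + complex.Im z ^+ 2))).
have msq : measurable_fun setT sq.
  have [mRe mIm] := (measurable_complexP (@id R[i])).1 (@measurable_id _ _ setT).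
  apply: measurableT_comp => //.
  apply: measurableT_comp => //; apply: measurable_funM => //.
  by apply: measurable_funD; exact: measurable_funX.
transitivity (\int[power_measure (@lebesgue_complex R) n]_t
    ((pi / a)%:E * (expR (- complex.Re
       (form (schur (Q : 'M[R[i]]_(1 + n))) (tuple_row t))))%:E))%E.
  apply: eq_integral => t _.
  (* The shift produced by completing the square. It depends on the tail only, so translation
     invariance removes it from the inner integral. *)
  pose c := (tuple_row t *m dlsubmx (Q : 'M[R[i]]_(1 + n))) 0 0 / pivot Q.
  transitivity (\int[@lebesgue_complex R]_x ((sq (c + x))%:E * (expR (- complex.Re
       (form (schur (Q : 'M[R[i]]_(1 + n))) (tuple_row t))))%:E))%E.
    apply: eq_integral => x _.
    rewrite tuple_row_cons (form_schur Qpos) -/c raddfD opprD expRD EFinM.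
    congr ((expR (- _))%:E * _)%E; rewrite pE.
    rewrite -[LHS]/(complex.Re ((a +i* 0) * (_ * _))) !Re_mul Re_conj Im_conj.
    rewrite -[complex.Re (a +i* 0)]/a -[complex.Im (a +i* 0)]/0; ring.
  rewrite ge0_integralZr//; last 2 first.
  - apply/measurable_EFinP; apply: (measurableT_comp msq).
    apply/measurable_complexP.
    apply: (complex_inD (measurable_function_algebra _ _)).
      exact: (complex_in_cst (measurable_function_algebra _ _)).
    by apply/measurable_complexP.
  - by move=> x _; rewrite lee_fin expR_ge0.
  congr (_ * _)%E.
  rewrite (integral_lebesgue_complex_translation c (f := EFin \o sq)); last 2 first.
  - exact/measurable_EFinP.
  - by move=> z; rewrite lee_fin expR_ge0.
  exact: integral_complex_gauss.
rewrite ge0_integralZl//; last 2 first.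
- by apply/measurable_EFinP/measurable_form; exact: measurable_tuple_row.
- by rewrite lee_fin divr_ge0 ?pi_ge0 ?ltW.
rewrite intE -EFinM; congr EFin; rewrite exprS; field.
by rewrite !gt_eqF.
Qed.

Lemma posdef_det n (Q : 'M[R[i]]_n) : posdef Q ->
  0 < complex.Re (\det Q) /\ \det Q = (complex.Re (\det Q))%:C.
Proof. by move=> /integral_gauss_centered[e e0 [-> _]]. Qed.

Lemma integral_gauss_form n (Q : 'M[R[i]]_n) (u : 'rV[R[i]]_n) : posdef Q ->
  (\int[power_measure (@lebesgue_complex R) n]_t
    (expR (- complex.Re (form Q (u + tuple_row t))))%:E)%E =
  (pi ^+ n / complex.Re (\det Q))%:E.
Proof.
move=> Qpos; have [e e0 [-> <-]] := integral_gauss_centered Qpos.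
rewrite -[RHS](@integral_power_measure_translation _ _ R
  (@lebesgue_complex R) (fun a z : R[i] => a + z) n (fun k => u 0 k)
  (fun t => (expR (- complex.Re (form Q (tuple_row t))))%:E)).
- apply: eq_integral => t _; congr (expR (- complex.Re (form Q _)))%:E.
  by apply/rowP => k; rewrite !mxE tnth_mktuple.
- move=> a; apply/measurable_complexP.
  apply: (complex_inD (measurable_function_algebra _ _)).
    exact: (complex_in_cst (measurable_function_algebra _ _)).
  by apply/measurable_complexP.
- exact: integral_lebesgue_complex_translation.
- by apply/measurable_EFinP/measurable_form; exact: measurable_tuple_row.
- by move=> t; rewrite lee_fin expR_ge0.
Qed.

Lemma integral_gauss_trace m n (A : 'M[R[i]]_m) (U : 'M[R[i]]_(m, n)) :
  posdef A ->
  (\int[power_measure (@lebesgue_complex R) (m * n)]_t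
    (expR (- complex.Re (\tr ((U + tuple_mx t)^t* *m A *m (U + tuple_mx t)))))%:E)%E
  = (pi ^+ (m * n) / complex.Re (\det A) ^+ n)%:E.
Proof.
move=> Apos.
have -> : complex.Re (\det A) ^+ n =
    complex.Re (\det (lin_mulmx A : 'M[R[i]]_(m * n))).
  have [_ dA] := posdef_det Apos.
  by rewrite det_lin_mulmx// dA -rmorphXn.
rewrite -(integral_gauss_form (mxvec U) (posdef_lin_mulmx n Apos)).
apply: eq_integral => t _.
by rewrite -form_lin_mulmx /form linearD /= mxvec_tuple_mx.
Qed.

(** Both sides are the squared Frobenius norm of [V]. *)
Lemma trace_gram m n (V : 'M[R[i]]_(m, n)) :
  \tr (V^t* *m V) = form 1%:M (mxvec V).
Proof.
rewrite -[V in LHS]mul1mx mulmxA -form_lin_mulmx mul_vec_lin /= mul1mx.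
by rewrite /form mulmx1.
Qed.

Lemma prod_standard_gauss m n (t : (m * n).-tuple R[i]) :
  (\prod_k (pi^-1 * expR (- (complex.Re (tnth t k) ^+ 2
    + complex.Im (tnth t k) ^+ 2)))%:E)%E =
  (pi ^- (m * n) *
    expR (- complex.Re (\tr ((tuple_mx t)^t* *m tuple_mx t))))%:E.
Proof.
rewrite prodEFin big_split/= prodr_const card_ord exprVn -expR_sum sumrN.
rewrite trace_gram mxvec_tuple_mx /form mulmx1 mxE [complex.Re _]raddf_sum.
congr (_ * expR (- _))%:E; apply: eq_bigr => k _.
by rewrite !mxE -[RHS]/(complex.Re (_ * _)) Re_mul Re_conj Im_conj; ring.
Qed.

End gaussian_integral.

(** * Uniqueness of a continuous density *)

Lemma mxvec_index_inj m n (p q : 'I_m * 'I_n) :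
  mxvec_index p.1 p.2 = mxvec_index q.1 q.2 -> p = q.
Proof.
case: p q => [i j] [i' j'] /= ijE; have [g gK _] := curry_mxvec_bij m n.
by rewrite -[LHS]gK// -[RHS]gK//= ijE.
Qed.

Section continuous_density.
Variable R : realType.

Lemma has_density_le d d' (Omega : measurableType d) (T : measurableType d')
    (P : probability Omega R) (mu : {measure set T -> \bar R})
    (X : Omega -> T) (f g : T -> R) (F : set_system T) (y : T) : Filter F ->
  has_density P mu X f -> has_density P mu X g ->
  (forall U, F U -> exists B, [/\ measurable B, B `<=` U & (0 < mu B)%E]) ->
  f @ F --> f y -> g @ F --> g y -> f y <= g y.
Proof.
move=> FF [mf f0 fE] [mg g0 gE] muF fy gy; rewrite leNgt; apply/negP => gf.
(* The points at one third and two thirds of the way from g y to f y. *)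
pose a := (2 * g y + f y) / 3; pose b := (g y + 2 * f y) / 3.
have ga : g y < a by rewrite /a; lra.
have ab : a < b by rewrite /a /b; lra.
have bf : b < f y by rewrite /b; lra.
have a0 : 0 <= a by rewrite (le_trans (g0 y))// ltW.
have [B [mB BU B0]] : exists B, [/\ measurable B,
    B `<=` [set t | g t < a /\ b < f t] & (0 < mu B)%E].
  by apply: muF; apply: filterI; [exact: (cvgr_lt _ gy)|exact: (cvgr_gt _ fy)].
have PB : (b%:E * mu B <= P (X @^-1` B) <= a%:E * mu B)%E.
  rewrite -!integral_cst//; apply/andP; split.
    rewrite fE//; apply: ge0_le_integral => //.
    - by move=> t _; rewrite lee_fin (le_trans a0)// ltW.
    - by apply/measurable_EFinP; exact: measurable_funTS.
    - by move=> t /BU[_ bt]; rewrite lee_fin ltW.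
  rewrite gE//; apply: ge0_le_integral => //.
  - by move=> t _; rewrite lee_fin.
  - by apply/measurable_EFinP; exact: measurable_funTS.
  - by move=> t /BU[ta _]; rewrite lee_fin ltW.
have b0 : 0 < b by rewrite (le_lt_trans a0).
(* Cancelling mu B needs it finite; an infinite value would force an infinite probability, because b
   > 0. *)
have muBoo : (mu B < +oo)%E.
  rewrite ltey; apply/eqP => muB; move: PB => /andP[+ _].
  rewrite muB mulry gtr0_sg// mul1e leye_eq => /eqP PB.
  have : (P (X @^-1` B) <= P (X @^-1` setT))%E.
    (* [X] is not assumed measurable, so monotonicity is taken from the integrals of the density. *)
    rewrite !fE//; apply: ge0_subset_integral => //.
    - by apply/measurable_EFinP; exact: measurable_funTS.
    - by move=> t _; rewrite lee_fin.
  rewrite preimage_setT probability_setT.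
  by rewrite PB.
move: PB => /andP[bP Pa]; have := le_trans bP Pa.
rewrite lee_pmul2r//; last by rewrite ge0_fin_numE.
by rewrite lee_fin leNgt ab.
Qed.

Lemma lebesgue_complex_square_gt0 (z : R[i]) (e : R) : 0 < e ->
  let B := [set w : R[i] | `|complex.Re w - complex.Re z| < e /\
                          `|complex.Im w - complex.Im z| < e] in
  measurable B /\ (0 < @lebesgue_complex R B)%E.
Proof.
move=> e0 B.
pose I (x : R) : set (measurableTypeR R) := (ball x e : set R).
have BE : B = @complex_pair R @^-1` (I (complex.Re z) `*` I (complex.Im z)).
  apply/seteqP; split => w /=;
    by rewrite /I /ball/= !(distrC (complex.Re z)) !(distrC (complex.Im z)).
have mI x : measurable (I x) by exact: measurable_ball.
split.
  rewrite BE -[X in measurable X]setTI; apply: measurable_complex_pair => //.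
  exact: measurableX.
rewrite BE /lebesgue_complex /pushforward -comp_preimage.
rewrite (_ : @complex_pair R \o @pair_complex R = id); last first.
  by apply/funext => -[].
rewrite preimage_id product_measure1E//.
have I0 x : (0 < @lebesgue_measure R (I x))%E.
  have IE : @lebesgue_measure R (I x) = (e *+ 2)%:E.
    exact: lebesgue_measure_ball (ltW e0).
  by rewrite IE lte_fin mulrn_wgt0.
by apply: mule_gt0; exact: I0.
Qed.

Lemma nbhs_complex_square (z : R[i]) (U : set R[i]) : nbhs z U ->
  exists2 e : R, 0 < e &
    [set w : R[i] | `|complex.Re w - complex.Re z| < e /\
                    `|complex.Im w - complex.Im z| < e] `<=` U.
Proof.
move=> /nbhs_ballP[[e e'] /= e0 eU].
move: e0; rewrite ltcE/= => /andP[/eqP e'0 e0]; rewrite {}e'0 in eU.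
(* Half the radius is enough, since the squared modulus stays below 2 (e / 2)^2, which is less than
   e^2. *)
exists (e / 2); first by rewrite divr_gt0.
have e20 : 0 < e / 2 by rewrite divr_gt0.
move=> w /= [rw iw]; apply: eU; rewrite /ball/= normc_def ltcR.
rewrite -[ltRHS]gtr0_norm// -[ltRHS]sqrtr_sqr ltr_sqrt ?exprn_gt0//.
rewrite !raddfB /= -[X in X + _]real_normK ?num_real//.
rewrite -[X in _ + X]real_normK ?num_real//.
rewrite (distrC (complex.Re z)) (distrC (complex.Im z)).
move: rw iw; set u := `|complex.Re w - _|; set v := `|complex.Im w - _| => ue ve.
have u0 : 0 <= u by exact: normr_ge0.
have v0 : 0 <= v by exact: normr_ge0.
nra.
Qed.

(** A neighbourhood of a matrix contains a product of open squares, one around each entry, and its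
    measure is the product of their positive areas. *)
Lemma lebesgue_matrix_nbhs m n (Y : 'M[R[i]]_(m, n)) (U : set 'M[R[i]]_(m, n)) :
  nbhs Y U ->
  exists B, [/\ measurable B, B `<=` U & (0 < @lebesgue_matrix R m n B)%E].
Proof.
case=> V VY VU.
have /choice[e eP] : forall ij : 'I_m * 'I_n, exists e : R, 0 < e /\
    [set w : R[i] | `|complex.Re w - complex.Re (Y ij.1 ij.2)| < e /\
      `|complex.Im w - complex.Im (Y ij.1 ij.2)| < e] `<=` V ij.1 ij.2.
  by move=> [i j]; have [e e0 eV] := nbhs_complex_square (VY i j); exists e.
pose B ij := [set w : R[i] |
    `|complex.Re w - complex.Re (Y ij.1 ij.2)| < e ij /\
    `|complex.Im w - complex.Im (Y ij.1 ij.2)| < e ij].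
have mB ij : measurable (B ij).
  by have [e0 _] := eP ij; have [] := lebesgue_complex_square_gt0 (Y ij.1 ij.2) e0.
have B0 ij : (0 < @lebesgue_complex R (B ij))%E.
  by have [e0 _] := eP ij; have [] := lebesgue_complex_square_gt0 (Y ij.1 ij.2) e0.
pose D : set 'M[R[i]]_(m, n) := [set A | forall ij, B ij (A ij.1 ij.2)].
have mD : measurable D.
  rewrite (_ : D = \bigcap_(ij in [set` (@predT ('I_m * 'I_n)%type)])
      ((fun A : 'M[R[i]]_(m, n) => A ij.1 ij.2) @^-1` B ij)); last first.
    by apply/seteqP; split => A DA ij; [move=> _|]; exact: DA.
  apply: fin_bigcap_measurable => // ij _.
  apply: sub_sigma_algebra; exists ij => //.
  by exists (B ij) => //; rewrite setTI.
exists D; split => //.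
  by move=> A DA; apply: VU => i j; have [_] := eP (i, j); apply; exact: (DA (i, j)).
(* [f] sends a position in the tuple to the matrix entry it stores, so that the box of matrices
   pulls back to a box of tuples. *)
have /choice[f fK] : forall k : 'I_(m * n), exists ij, mxvec_index ij.1 ij.2 = k.
  by move=> k; case/mxvec_indexP: k => i j; exists (i, j).
have DE : @tuple_mx R m n @^-1` D = tuple_box (fun k => B (f k)).
  apply/seteqP; split => t /= Dt.
    by move=> k; have := Dt (f k); rewrite mxE fK.
  move=> ij; rewrite mxE.
  by have := Dt (mxvec_index ij.1 ij.2); rewrite (mxvec_index_inj (fK _)).
rewrite -[X in (_ < X)%E]/(power_measure _ _ (@tuple_mx R m n @^-1` D)) DE.
rewrite -[tuple_box _]setIT -integral_indic//; last exact: measurable_tuple_box.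
rewrite (eq_integral
    (fun t => (\prod_k (\1_(B (f k)) (tnth t k))%:E)%E)); last first.
  move=> t _; rewrite prodEFin indicE; congr EFin.
  have [/set_mem tB|tB] := boolP (t \in _).
    by rewrite big1// => k _; rewrite indicE mem_set//; exact: tB.
  move: tB; rewrite notin_setE => /existsNP[k tk].
  by rewrite (bigD1 k)//= indicE memNset// mul0r.
rewrite (@integral_power_measure_prod _ _ _ (@lebesgue_complex R) _
  (fun k w => (\1_(B (f k)) w)%:E)).
- elim/big_ind: _ => [|x y x0 y0|k _]; first by rewrite lte_fin.
    exact: mule_gt0.
  by rewrite integral_indic// setIT; exact: B0.
- by move=> k; apply/measurable_EFinP; exact: measurable_indic.
- by move=> k x; rewrite lee_fin.
Qed.

Section continuous_functions.
Variable T : topologicalType.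

Lemma continuous_function_algebra : function_algebra (fun f : T -> R => continuous f).
Proof.
split=> [a|f g cf cg|f g cf cg] x; first exact: cvg_cst.
- exact: (cvgD (cf x) (cg x)).
- exact: (cvgM (cf x) (cg x)).
Qed.

End continuous_functions.

(** Matrix neighbourhoods are entrywise, and real and imaginary parts are bounded by the modulus.
    Complex balls have complex radii, hence [e'%:C]. *)
Lemma continuous_mx_id m n :
  mx_in (fun f : 'M[R[i]]_(m, n) -> R => continuous f) id.
Proof.
have key (h : R[i] -> R) i j :
    (forall z (e : R), 0 < e -> exists2 e' : R, 0 < e' & forall w : R[i],
      `|z - w| < e'%:C -> `|h z - h w| < e) ->
    continuous (fun A : 'M[R[i]]_(m, n) => h (A i j)).
  move=> hc A U /nbhs_ballP[e /= e0 eU].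
  have [e' e'0 e'P] := hc (A i j) e e0.
  exists (fun i' j' => ball (A i' j') e'%:C).
    by move=> i' j'; apply: nbhsx_ballx; rewrite ltcR.
  by move=> B AB; apply: eU; apply: e'P; exact: AB.
by move=> i j; split; apply: key => z e e0; exists e => // -[wr wi];
  case: z => [zr zi]; rewrite normc_def ltcR /=; apply: le_lt_trans;
  rewrite -sqrtr_sqr ler_wsqrtr// ?lerDl ?lerDr sqr_ge0.
Qed.

End continuous_density.

(** * The density of the observation *)

(** [U] is the regularised least-squares solution, that is, L U = r X^* T. This equation and its
    adjoint match the cross terms. *)
Lemma complete_square (C : numClosedFieldType) m n p (r : C)
    (X : 'M[C]_(m, n)) (S : 'M[C]_(n, p)) (T : 'M[C]_(m, p)) :
  let L := 1%:M + (r ^+ 2) *: (X^t* *m X) in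
  let U := r *: (invmx L *m (X^t* *m T)) in
  Num.conj r = r -> L \in unitmx -> L^t* = L ->
  \tr (S^t* *m S) + \tr ((T - r *: (X *m S))^t* *m (T - r *: (X *m S))) =
  \tr ((- U + S)^t* *m L *m (- U + S)) +
  (\tr (T^t* *m T) -
   \tr ((r ^+ 2) *: (T^t* *m X *m invmx L *m X^t* *m T))).
Proof.
move=> L U rr Lu LL.
have LU : L *m U = r *: (X^t* *m T) by rewrite /U -scalemxAr mulKVmx.
have UL : U^t* *m L = r *: (T^t* *m X).
  by rewrite -[in LHS]LL -adjmxM LU adjmxZ rr adjmxM trmxCK.
have adjN a b (A : 'M[C]_(a, b)) : (- A)^t* = - A^t*.
  by rewrite linearN /= map_mxN.
have SLS : S^t* *m L *m S = S^t* *m S + r ^+ 2 *: (S^t* *m X^t* *m X *m S).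
  by rewrite /L mulmxDr mulmx1 mulmxDl -scalemxAr -scalemxAl !mulmxA.
have UXT : U^t* *m X^t* *m T = r *: (T^t* *m X *m invmx L *m X^t* *m T).
  by rewrite -[U^t*](mulmxK Lu) UL -!scalemxAl.
(* From here only the identities collected above are used, so the expansion must not unfold [U] or
   [L]. *)
clearbody U; clearbody L.
rewrite !adjmxD !adjN adjmxZ rr adjmxM.
rewrite !(mulmxDl, mulmxDr, mulmxN, mulNmx) -!mulmxA LU !mulmxA UL.
rewrite -!(scalemxAl, scalemxAr) !mulmxA UXT SLS !scalerA.
have trN (A : 'M[C]_p) : \tr (- A) = - \tr A by exact: linearN.
rewrite !(mxtraceD, trN, mxtraceZ).
ring.
Qed.

(** * Closed form of the density of the observation *)

Section marginal_density.
Variables (R : realType) (m k n : nat) (rho : R).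
Hypothesis rho0 : 0 < rho.

Definition gram (X : 'M[R[i]]_(m, k)) : 'M[R[i]]_k :=
  1%:M + rho%:C *: (X^t* *m X).

Definition trace_stat (X : 'M[R[i]]_(m, k)) (Y : 'M[R[i]]_(m, n)) : R[i] :=
  \tr (rho%:C *: (Y^t* *m X *m invmx (gram X) *m X^t* *m Y)).

(** The complex Gaussian density with independent columns of covariance I + rho X X^*: its
    determinant is that of [gram X] by Sylvester's identity, and its inverse is expanded by
    Woodbury's. *)
Definition marginal_density X Y : R :=
  pi ^- (m * n) / complex.Re (\det (gram X)) ^+ n *
  expR (- complex.Re (\tr (Y^t* *m Y) - trace_stat X Y)).

Lemma posdef_gram X : posdef (gram X).
Proof. by apply: posdef_1D_gram; rewrite lecR ltW. Qed.

Lemma det_gram_gt0 X : 0 < complex.Re (\det (gram X)).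
Proof. by have [] := posdef_det (posdef_gram X). Qed.

Lemma gram_unit X : gram X \in unitmx.
Proof.
have [d0 dE] := posdef_det (posdef_gram X).
rewrite unitmxE unitfE dE; apply/eqP => /(congr1 (@complex.Re R)) /= d00.
by rewrite d00 ltxx in d0.
Qed.

Lemma marginal_density_ge0 X Y : 0 <= marginal_density X Y.
Proof.
rewrite /marginal_density mulr_ge0 ?expR_ge0// divr_ge0//.
  by rewrite invr_ge0 exprn_ge0// pi_ge0.
by rewrite exprn_ge0// ltW// det_gram_gt0.
Qed.

Lemma quadratic_in (C : ('M[R[i]]_(m, n) -> R) -> Prop) X :
  function_algebra C -> mx_in C id ->
  C (fun Y => - complex.Re (\tr (Y^t* *m Y) - trace_stat X Y)).
Proof.
move=> CA Cid; apply: (function_algebraN CA).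
have Cadj : mx_in C (fun Y : 'M[R[i]]_(m, n) => Y^t*).
  exact: (mx_in_adjoint CA).
have Ct : complex_in C (fun Y => \tr (Y^t* *m Y)).
  by apply: (complex_in_trace CA); exact: (mx_inM CA).
have Cs : complex_in C (trace_stat X).
  rewrite /trace_stat; under eq_fun do rewrite mxtraceZ.
  apply: (complex_inM CA); first exact: (complex_in_cst CA).
  apply: (complex_in_trace CA); apply: (mx_inM CA) => //.
  by do 3 (apply: (mx_inM CA); last exact: (mx_in_cst CA)).
case: Cs => /(function_algebraN CA) Cs _; case: Ct => Ct _; case: CA => _ CD _.
have := CD _ _ Ct Cs; congr (C _); apply/funext => Y.
by rewrite [in RHS]raddfB.
Qed.

Lemma measurable_marginal_density X : measurable_fun setT (marginal_density X).
Proof.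
apply: measurable_funM; first exact: measurable_cst.
apply: measurableT_comp => //.
apply: (quadratic_in (C := fun f => measurable_fun setT f)).
  exact: measurable_function_algebra.
by apply/measurable_mxP; exact: measurable_id.
Qed.

Lemma continuous_marginal_density X : continuous (marginal_density X).
Proof.
have [Cc _ CM] := continuous_function_algebra R 'M[R[i]]_(m, n).
apply: (CM (fun=> _) _ (Cc _)) => Y.
apply: continuous_comp; last exact: continuous_expR.
move: Y; apply: (quadratic_in (C := fun f => continuous f)).
  exact: continuous_function_algebra.
exact: continuous_mx_id.
Qed.

(* The density of (H, Y), where Y = sqrt rho X H + W. *)
Definition joint_density (X : 'M[R[i]]_(m, k)) (S : 'M[R[i]]_(k, n))
    (V : 'M[R[i]]_(m, n)) : R :=
  pi ^- (k * n) * expR (- complex.Re (\tr (S^t* *m S))) *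
  (pi ^- (m * n) * expR (- complex.Re (\tr (
     (V - (Num.sqrt rho)%:C *: (X *m S))^t* *m (V - (Num.sqrt rho)%:C *: (X *m S)))))).

Lemma joint_density_ge0 X S V : 0 <= joint_density X S V.
Proof.
have pi_ge0 l : 0 <= pi ^- l :> R by rewrite invr_ge0 exprn_ge0// pi_ge0.
by rewrite !mulr_ge0// expR_ge0.
Qed.

Lemma measurable_joint_density d' (T : measurableType d') X
    (S : T -> 'M[R[i]]_(k, n)) (V : T -> 'M[R[i]]_(m, n)) :
  measurable_fun setT S -> measurable_fun setT V ->
  measurable_fun setT (fun x => joint_density X (S x) (V x)).
Proof.
move=> /measurable_mxP mS /measurable_mxP mV.
have CA := measurable_function_algebra T R.
have mgram l (F : T -> 'M[R[i]]_(l, n)) :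
    mx_in (fun g => measurable_fun setT g) F ->
    measurable_fun setT (fun x => expR (- complex.Re (\tr ((F x)^t* *m F x)))).
  move=> mF; apply: measurable_expR_Re; apply: (complex_in_trace CA).
  by apply: (mx_inM CA) => //; exact: (mx_in_adjoint CA).
apply: measurable_funM; apply: measurable_funM => //; apply: mgram => //.
rewrite (_ : (fun _ => _) = fun x => V x + (- (Num.sqrt rho)%:C *: X) *m S x); last first.
  by apply/funext => x; rewrite -scalemxAl scaleNr.
by apply: (mx_inD CA) => //; apply: (mx_inM CA) => //; exact: (mx_in_cst CA).
Qed.

Lemma integral_marginal_density X Y :
  (\int[power_measure (@lebesgue_complex R) (k * n)]_s
    (joint_density X (tuple_mx s) Y)%:E)%E =
  (marginal_density X Y)%:E.
Proof.
pose r : R[i] := (Num.sqrt rho)%:C.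
have r2 : r ^+ 2 = rho%:C by rewrite /r -rmorphXn /= sqr_sqrtr// ltW.
have rr : Num.conj r = r by exact: conjc_real.
(* The conditional mean of H given Y, around which the completed square is centred. *)
pose U := r *: (invmx (gram X) *m (X^t* *m Y)).
pose c := pi ^- (k * n) * pi ^- (m * n) *
  expR (- complex.Re (\tr (Y^t* *m Y) - trace_stat X Y)).
have c0 : 0 <= c.
  by rewrite mulr_ge0 ?expR_ge0// mulr_ge0// invr_ge0 exprn_ge0// pi_ge0.
have [LL _] := posdef_gram X.
have := @complete_square R[i] m k n r X _ Y; rewrite r2 => /(_ _ rr (gram_unit X) LL) sqE.
transitivity (\int[power_measure (@lebesgue_complex R) (k * n)]_s (c%:E *
    (expR (- complex.Re (\tr ((- U + tuple_mx s)^t* *m gram X *m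
      (- U + tuple_mx s)))))%:E))%E.
  apply: eq_integral => s _; rewrite -EFinM /joint_density; congr (_%:E).
  rewrite /c mulrACA -expRD -opprD -raddfD sqE raddfD opprD expRD.
  by rewrite [expR _ * _]mulrC mulrA.
rewrite ge0_integralZl//; last first.
  apply/measurable_EFinP; apply: measurable_expR_Re.
  have CA := measurable_function_algebra ((k * n).-tuple R[i]) R.
  have CU : mx_in (fun g => measurable_fun setT g)
      (fun s : (k * n).-tuple R[i] => - U + tuple_mx s).
    apply: (mx_inD CA); first exact: (mx_in_cst CA).
    by apply/measurable_mxP; exact: measurable_tuple_mx.
  apply: (complex_in_trace CA); apply: (mx_inM CA) => //.
  by apply: (mx_inM CA); [exact: (mx_in_adjoint CA)|exact: (mx_in_cst CA)].
rewrite (integral_gauss_trace _ (posdef_gram X)) -EFinM; congr (_%:E).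
rewrite /c /marginal_density.
have pi_neq0 l : pi ^+ l != 0 :> R by rewrite expf_neq0// gt_eqF// pi_gt0.
have := pi_neq0 (k * n)%N; have := pi_neq0 (m * n)%N.
have : complex.Re (\det (gram X)) ^+ n != 0.
  by rewrite expf_neq0// gt_eqF// det_gram_gt0.
move: (pi ^+ (k * n)) (pi ^+ (m * n)) (_ ^+ n) (expR _) => a b e h e0 b0 a0.
by field; rewrite e0 b0 a0.
Qed.

(** Isolates a positive factor free of [X]; the power of the determinant moves into the exponent as
    a logarithm. *)
Lemma marginal_densityE X Y : marginal_density X Y =
  pi ^- (m * n) * expR (- complex.Re (\tr (Y^t* *m Y))) *
  expR (complex.Re (trace_stat X Y) - n%:R * ln (complex.Re (\det (gram X)))).
Proof.
have -> : expR (complex.Re (trace_stat X Y) -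
    n%:R * ln (complex.Re (\det (gram X)))) =
    expR (complex.Re (trace_stat X Y)) / complex.Re (\det (gram X)) ^+ n.
  by rewrite expRD expRN expRM_natl lnK// posrE det_gram_gt0.
have -> : marginal_density X Y =
    pi ^- (m * n) / complex.Re (\det (gram X)) ^+ n *
    (expR (- complex.Re (\tr (Y^t* *m Y))) * expR (complex.Re (trace_stat X Y))).
  by rewrite /marginal_density raddfB opprB addrC expRD.
by rewrite mulrACA; congr (_ * _); exact: mulrC.
Qed.

End marginal_density.

Lemma patch_mule_indic (R : realType) T (D : set T) (f : T -> \bar R) x :
  (f \_ D) x = (f x * (\1_D x)%:E)%E.
Proof. by rewrite patchE indicE; case: ifP; rewrite ?mule1 ?mule0. Qed.

(** * Law of the observation *)

Section observation.
Variables (R : realType) (m k n : nat) (rho : R).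
Hypothesis rho0 : 0 < rho.
Variables (d : measure_display) (Omega : measurableType d)
  (P : probability Omega R).
Variables (H : {RV P >-> 'M[R[i]]_(k, n)}) (W : {RV P >-> 'M[R[i]]_(m, n)}).
Hypothesis HW_indep : mutually_independent P (entries H W).
Hypothesis HW_gauss : forall s, standard_complex_gaussian P (entries H W s).
Local Notation r := ((Num.sqrt rho)%:C).
Local Notation leb l := (power_measure (@lebesgue_complex R) l).

Definition standard_gauss (z : R[i]) : R :=
  pi^-1 * expR (- (complex.Re z ^+ 2 + complex.Im z ^+ 2)).

Lemma measurable_standard_gauss : measurable_fun setT standard_gauss.
Proof.
have [mRe mIm] := (measurable_complexP (@id R[i])).1 (@measurable_id _ _ setT).
apply: measurable_funM => //; apply: measurableT_comp => //.
apply: measurableT_comp => //.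
by apply: measurable_funD; exact: measurable_funX.
Qed.

(** Lines up the entries of H, then those of W, in a single index, as the power measure requires. *)
Definition coordinate (a : 'I_(k * n + m * n)) (w : Omega) : R[i] :=
  row_mx (mxvec (H w)) (mxvec (W w)) 0 a.

Definition entry_index (s : 'I_k * 'I_n + 'I_m * 'I_n) : 'I_(k * n + m * n) :=
  match s with
  | inl ij => lshift (m * n) (mxvec_index ij.1 ij.2)
  | inr ij => rshift (k * n) (mxvec_index ij.1 ij.2)
  end.

Lemma coordinate_entry s : coordinate (entry_index s) = entries H W s.
Proof.
apply/funext => w; case: s => [[i j]|[i j]]; rewrite /coordinate /=.
  by rewrite row_mxEl mxvecE.
by rewrite row_mxEr mxvecE.
Qed.

Lemma entry_index_surj a : exists s, entry_index s = a.
Proof.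
case: (split_ordP a) => b ->; case/mxvec_indexP: b => i j.
  by exists (inl (i, j)).
by exists (inr (i, j)).
Qed.

Lemma entry_index_bij : bijective entry_index.
Proof.
have /choice[g gK] := entry_index_surj.
exists g; last exact: gK.
move=> s; have := gK (entry_index s).
move: (g (entry_index s)) => t; case: t s => [p|p] [q|q] /=.
- by move=> /lshift_inj/mxvec_index_inj ->.
- by move=> /eqP; rewrite eq_lrshift.
- by move=> /eqP; rewrite eq_rlshift.
- by move=> /rshift_inj/mxvec_index_inj ->.
Qed.

Lemma measurable_entries s : measurable_fun setT (entries H W s).
Proof.
by case: s => [[i j]|[i j]] /=; apply/measurable_complexP;
  apply: (measurable_mxP _).1; exact: measurable_funPT.
Qed.

Lemma has_density_coordinates (B : set ((k * n + m * n).-tuple R[i])) :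
  measurable B ->
  P ((fun w => [tuple coordinate a w | a < k * n + m * n]) @^-1` B) =
  (\int[leb (k * n + m * n)]_(t in B)
    \prod_a (standard_gauss (tnth t a))%:E)%E.
Proof.
move=> mB; apply: (@has_density_tuple R _ _ _ _ P (@lebesgue_complex R) _
  coordinate standard_gauss) => //.
- move=> a; have [s <-] := entry_index_surj a.
  by rewrite coordinate_entry; exact: measurable_entries.
- move=> a; have [s <-] := entry_index_surj a.
  by rewrite coordinate_entry; exact: HW_gauss.
- exact: measurable_standard_gauss.
- by move=> x; rewrite mulr_ge0 ?expR_ge0// invr_ge0 pi_ge0.
- move=> A mA.
  (* Independence is used for the whole family at once, then reindexed along [entry_index]. *)
  have := HW_indep finset.setT (fun s => mA (entry_index s)).
  rewrite (reindex _ (onW_bij _ entry_index_bij)) /=.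
  under [in X in _ -> X]eq_bigr do rewrite coordinate_entry.
  under eq_bigl do rewrite finset.in_setT.
  move=> <-; congr (P _); apply/seteqP; split => w ZA.
    by move=> s _; rewrite -coordinate_entry; exact: ZA.
  move=> a _; have [s <-] := entry_index_surj a; rewrite coordinate_entry.
  by apply: ZA => /=; rewrite finset.in_setT.
Qed.

(** True for every [X]: subtracting the signal inside [joint_density] gives back the noise
    [tuple_mx t]. *)
Lemma prod_cat_gauss X (s : (k * n).-tuple R[i]) (t : (m * n).-tuple R[i]) :
  (\prod_a (standard_gauss (tnth (cat_tuple s t) a))%:E)%E =
  (joint_density rho X (tuple_mx s)
    (r *: (X *m tuple_mx s) + tuple_mx t))%:E.
Proof.
rewrite big_split_ord /joint_density [_ + _ - _]addrC addKr EFinM.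
rewrite -!prod_standard_gauss; congr (_ * _)%E; apply: eq_bigr => a _.
  by rewrite (tnth_lshift s t).
by rewrite (tnth_rshift s t).
Qed.

Lemma tuple_mxD (C : 'M[R[i]]_(m, n)) (t : (m * n).-tuple R[i]) :
  tuple_mx [tuple mxvec C 0 a + tnth t a | a < m * n] = C + tuple_mx t.
Proof. by apply/matrixP => i j; rewrite !mxE tnth_mktuple mxvecE. Qed.

Lemma has_density_observation (X : 'M[R[i]]_(m, k)) :
  has_density P (@lebesgue_matrix R m n) (fun w => r *: (X *m H w) + W w)
    (marginal_density rho X).
Proof.
split; [exact: measurable_marginal_density|exact: marginal_density_ge0|].
move=> B mB.
pose ltup (t : (k * n + m * n).-tuple R[i]) :=
  [tuple tnth t (lshift (m * n) a) | a < k * n].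
pose rtup (t : (k * n + m * n).-tuple R[i]) :=
  [tuple tnth t (rshift (k * n) a) | a < m * n].
(* Rebuilds the observation from the tuple of all entries, so an event about Y becomes an event
   about that tuple. *)
pose phi t := r *: (X *m tuple_mx (ltup t)) + tuple_mx (rtup t).
have phi_cat s t : phi (cat_tuple s t) = r *: (X *m tuple_mx s) + tuple_mx t.
  rewrite /phi (_ : ltup _ = s); last first.
    by apply: eq_from_tnth => a; rewrite tnth_mktuple (tnth_lshift s t).
  rewrite (_ : rtup _ = t)//.
  by apply: eq_from_tnth => a; rewrite tnth_mktuple (tnth_rshift s t).
have mphi : measurable_fun setT phi.
  have ml : measurable_fun setT ltup.
    apply/measurable_fun_tnthP => a; rewrite (_ : _ \o _ =
      (@tnth _ _)^~ (lshift (m * n) a)).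
      exact: measurable_tnth.
    by apply/funext => t /=; rewrite tnth_mktuple.
  have mr : measurable_fun setT rtup.
    apply/measurable_fun_tnthP => a; rewrite (_ : _ \o _ =
      (@tnth _ _)^~ (rshift (k * n) a)).
      exact: measurable_tnth.
    by apply/funext => t /=; rewrite tnth_mktuple.
  have CA := measurable_function_algebra ((k * n + m * n).-tuple R[i]) R.
  apply/measurable_mxP; apply: (mx_inD CA).
    rewrite (_ : (fun _ => _) = fun t => (r *: X) *m tuple_mx (ltup t)); last first.
      by apply/funext => t; rewrite scalemxAl.
    apply: (mx_inM CA); first exact: (mx_in_cst CA).
    by apply/measurable_mxP; apply: measurableT_comp => //; exact: measurable_tuple_mx.
  by apply/measurable_mxP; apply: measurableT_comp => //; exact: measurable_tuple_mx.
have mphiB : measurable (phi @^-1` B).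
  by rewrite -[X in measurable X]setTI; exact: mphi.
(* With the indicator in the integrand, the event constrains only the second argument once the noise
   has been shifted. *)
pose Psi (S : 'M[R[i]]_(k, n)) V := ((joint_density rho X S V)%:E * (\1_B V)%:E)%E.
have Psi0 S V : (0 <= Psi S V)%E by rewrite mule_ge0 ?lee_fin ?joint_density_ge0.
have mPsi d' (T : measurableType d') (S : T -> 'M[R[i]]_(k, n))
    (V : T -> 'M[R[i]]_(m, n)) :
    measurable_fun setT S -> measurable_fun setT V ->
    measurable_fun setT (fun x => Psi (S x) (V x)).
  move=> mS mV; apply: emeasurable_funM.
    by apply/measurable_EFinP; exact: measurable_joint_density.
  apply/measurable_EFinP.
  by apply: (@measurableT_comp _ _ _ _ _ _ (\1_B : 'M[R[i]]_(m, n) -> R) _ V) => //.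
have mtm l := @measurable_tuple_mx R l n.
transitivity (P ((fun w => [tuple coordinate a w | a < k * n + m * n]) @^-1`
    (phi @^-1` B))).
  suff -> : (fun w => r *: (X *m H w) + W w) =
      phi \o (fun w => [tuple coordinate a w | a < k * n + m * n]) by [].
  apply/funext => w; rewrite [RHS]/= /phi.
  have -> : tuple_mx (ltup [tuple coordinate a w | a < k * n + m * n]) = H w.
    apply/matrixP => i j; rewrite mxE !tnth_mktuple /coordinate.
    by rewrite row_mxEl mxvecE.
  have -> // : tuple_mx (rtup [tuple coordinate a w | a < k * n + m * n]) = W w.
  apply/matrixP => i j; rewrite mxE !tnth_mktuple /coordinate.
  by rewrite row_mxEr mxvecE.
rewrite has_density_coordinates// [LHS]integral_mkcond.
set f := (X in X \_ _).
have mf : measurable_fun setT (f \_ (phi @^-1` B)).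
  apply/(measurable_restrictT _ mphiB) => //; apply: measurable_funTS.
  apply: (@measurable_prod_tnth _ R[i] R _ (fun=> EFin \o standard_gauss)) => _.
  by apply/measurable_EFinP; exact: measurable_standard_gauss.
have f0 t : (0 <= (f \_ (phi @^-1` B)) t)%E.
  rewrite patch_mule_indic mule_ge0 ?lee_fin// /f.
  by apply: prode_ge0 => a _; rewrite lee_fin mulr_ge0 ?expR_ge0// invr_ge0 pi_ge0.
rewrite integral_power_measureD//.
transitivity (\int[leb (k * n)]_s \int[leb (m * n)]_t
    Psi (tuple_mx s) (tuple_mx t))%E.
  apply: eq_integral => s _.
  pose C : 'M[R[i]]_(m, n) := r *: (X *m tuple_mx s).
  (* For fixed H, passing from W to Y is the translation by [C]. *)
  rewrite -[RHS](@integral_power_measure_translation _ _ R (@lebesgue_complex R)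
    (fun a z : R[i] => a + z) _ (fun a => mxvec C 0 a)
    (fun t => Psi (tuple_mx s) (tuple_mx t))) //.
  - apply: eq_integral => t _; rewrite tuple_mxD patch_mule_indic.
    rewrite /f (prod_cat_gauss X) /Psi; congr (_ * _)%E.
    have -> // : \1_(phi @^-1` B) (cat_tuple s t) = \1_B (C + tuple_mx t) :> R.
    by rewrite -[C + _](phi_cat s t).
  - move=> a; apply/measurable_complexP.
    apply: (complex_inD (measurable_function_algebra _ _)).
      exact: (complex_in_cst (measurable_function_algebra _ _)).
    by apply/measurable_complexP.
  - exact: integral_lebesgue_complex_translation.
  - apply: (mPsi _ _ (fun=> tuple_mx s) (@tuple_mx R m n)).
      exact: measurable_cst.
    exact: mtm.
(* Exchanging the integrals lets H be integrated out at fixed Y. *)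
rewrite (fubini_tonelli (fun p => Psi (tuple_mx p.1) (tuple_mx p.2)))//; last first.
  apply: (mPsi _ _ (fun p => tuple_mx p.1) (fun p => tuple_mx p.2)).
    exact: (measurableT_comp (mtm k) measurable_fst).
  exact: (measurableT_comp (mtm m) measurable_snd).
rewrite ge0_integral_pushforward//; last 3 first.
- exact: mtm.
- apply/measurable_EFinP; apply: measurable_funTS.
  exact: measurable_marginal_density.
- by move=> V _; rewrite lee_fin marginal_density_ge0.
rewrite [RHS]integral_mkcond; apply: eq_integral => t _.
rewrite patch_mule_indic /= -(integral_marginal_density rho0).
rewrite -ge0_integralZr//; last 2 first.
- apply/measurable_EFinP.
  exact: (measurable_joint_density rho X (mtm k) (measurable_cst _)).
- by move=> s _; rewrite lee_fin joint_density_ge0.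
Qed.

End observation.

(* The trace and the determinant below are real, so Re only changes their type
   from R[i] to R. *)
Theorem mainTheorem4 (R : realType) (T M N L : nat) (rho : R)
    (S : 'I_L -> 'M[R[i]]_(2 * T, M))
    (d : measure_display) (Omega : measurableType d) (P : probability Omega R)
    (H : {RV P >-> 'M[R[i]]_(M, N)}) (W : {RV P >-> 'M[R[i]]_(2 * T, N)})
    (p : 'M[R[i]]_(2 * T, M) -> 'M[R[i]]_(2 * T, N) -> R) :
  (0 < T)%N -> (0 < M)%N -> (0 < N)%N -> 0 < rho ->
  mutually_independent P (entries H W) ->
  (forall k, standard_complex_gaussian P (entries H W k)) ->
  (forall X : 'M[R[i]]_(2 * T, M),
    has_density P (@lebesgue_matrix R (2 * T) N)
      (fun w => (Num.sqrt rho)%:C *: (X *m H w) + W w) (p X) /\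
    continuous (p X)) ->
  forall Y : 'M[R[i]]_(2 * T, N),
    argmax (fun l => p (S l) Y) =
    argmax (fun l =>
      complex.Re (\tr (rho%:C *:
        (Y^t* *m S l *m invmx (1%:M + rho%:C *: ((S l)^t* *m S l))
           *m (S l)^t* *m Y)))
      - N%:R * ln (complex.Re (\det (1%:M + rho%:C *: ((S l)^t* *m S l))))).
Proof.
move=> _ _ _ rho0 indep gauss hp Y.
have pE l : p (S l) Y = marginal_density rho (S l) Y.
  have [pd pc] := hp (S l).
  have qd := has_density_observation rho0 indep gauss (S l).
  have qc := @continuous_marginal_density R (2 * T) M N rho (S l).
  have pos := @lebesgue_matrix_nbhs R (2 * T) N Y.
  apply/eqP; rewrite eq_le; apply/andP; split.
    exact: (has_density_le _ pd qd pos (pc Y) (qc Y)).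
  exact: (has_density_le _ qd pd pos (qc Y) (pc Y)).
(* The factor in front of the exponential is positive and common to all candidates, so comparing
   densities amounts to comparing exponents. *)
have mono j l : (p (S j) Y <= p (S l) Y) =
    (complex.Re (trace_stat rho (S j) Y) -
       N%:R * ln (complex.Re (\det (gram rho (S j)))) <=
     complex.Re (trace_stat rho (S l) Y) -
       N%:R * ln (complex.Re (\det (gram rho (S l))))).
  rewrite !pE (marginal_densityE rho0 (S j)) (marginal_densityE rho0 (S l)).
  rewrite ler_pM2l ?ler_expR//.
  by rewrite mulr_gt0 ?expR_gt0// invr_gt0 exprn_gt0// pi_gt0.
apply/seteqP; split => l lmax j.
  have := lmax j; rewrite mono; exact.
by rewrite mono; exact: lmax.
Qed.
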